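(* Suppose we are given membership oracle access to a measurable set $S\subseteq\Pi_d=\{0,1\}^d$ whose measure under some unknown Boolean product distribution $\mathcal{D}(z^\star)$ is at least some constant $\alpha>0$, suppose that the truncated distribution $\mathcal{D}_S(z^\star)$ satisfies the anti-concentration condition with parameter $\lambda>0$: for all unit vectors $w\in\mathbb{R}^d$, $\|w\|_2=1$, and all $c\in\mathbb{R}$, $\Pr_{x\sim\mathcal{D}_S(z^\star)}[w^Tx\notin(c-\lambda,c+\lambda)]\ge\lambda$, and suppose that we are given samples from the truncation $\mathcal{D}_S(z^\star)$. Then there exists a sample polynomial-time algorithm that recovers an estimation $\overline{z}$ of $z^\star$. For any $\varepsilon>0$, the algorithm uses $\mathrm{poly}(1/\alpha)^{\mathrm{poly}(1/\lambda)}\cdot\widetilde{O}(d/\varepsilon^2)$ truncated samples from $\mathcal{D}_S(z^\star)$ and membership queries to $S$ and guarantees that $\|z^\star-\overline{z}\|_2\le\varepsilon$ with probability $99\%$. Under these conditions, it also holds that $D_{TV}(\mathcal{D}(z^\star),\mathcal{D}(\overline{z}))\le O(\varepsilon)$.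
   Context: A Boolean product distribution with parameter vector $p=(p_1,\dots,p_d)$ is the product of $d$ independent Bernoulli distributions with parameters $p_i$; its natural parameter vector is $z=(z_1,\dots,z_d)$ with $z_i=\log\frac{p_i}{1-p_i}$, and in terms of $z$ it is $\mathcal{D}(z;x)=\exp(x^Tz)/\prod_{i\in[d]}(1+\exp(z_i))$ for $x\in\Pi_d$. For $S\subseteq\Pi_d$, $\mathcal{D}(z;S)=\sum_{x\in S}\mathcal{D}(z;x)$, and the truncation $\mathcal{D}_S(z)$ assigns probability $\mathcal{D}(z;x)/\mathcal{D}(z;S)$ to $x\in S$ and $0$ otherwise. A membership oracle for $S$ reveals, for any $x\in\Pi_d$, whether $x\in S$. $D_{TV}$ is total variation distance. $\mathrm{poly}(\cdot)$ denotes an unspecified fixed polynomial and $\widetilde{O}$ hides polylogarithmic factors. *)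

(* Defs.v *)
From HB Require Import structures.
From mathcomp Require Import all_boot all_order all_algebra.
From mathcomp Require Import reals sequences exp.

Set Implicit Arguments.
Unset Strict Implicit.
Unset Printing Implicit Defensive.
Import Order.TTheory GRing.Theory Num.Theory.
Local Open Scope ring_scope.

Definition cube (d : nat) : finType := {ffun 'I_d -> bool}.

Section Distributions.
Context {R : realType} {d : nat}.
Implicit Types (z w : 'rV[R]_d) (x : cube d) (S : {set cube d}).

Definition dotc w x : R := \sum_(i < d) w 0 i * (x i)%:R.

(* Euclidean norm: the library's norm on ['rV[R]_d] is the sup norm. *)
Definition l2norm w : R := Num.sqrt (\sum_(i < d) w 0 i ^+ 2).

Definition prodD z x : R :=
  expR (dotc z x) / \prod_(i < d) (1 + expR (z 0 i)).

Definition mass (f : cube d -> R) S : R := \sum_(x in S) f x.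

Definition prodD_trunc z S x : R :=
  if x \in S then prodD z x / mass (prodD z) S else 0.

Definition dTV (f g : cube d -> R) : R := 2^-1 * \sum_(x : cube d) `|f x - g x|.

Definition anti_concentrated (f : cube d -> R) (lambda : R) : Prop :=
  forall (w : 'rV[R]_d) (c : R), l2norm w = 1 ->
    lambda <= mass f [set x | ~~ (c - lambda < dotc w x < c + lambda)].

(* The exponential-family form agrees with the product of Bernoulli
   distributions whose log-odds are the coordinates of the parameter. *)
Lemma prodD_bernoulli (p z : 'rV[R]_d) x :
  (forall i, 0 < p 0 i < 1) ->
  (forall i, z 0 i = ln (p 0 i / (1 - p 0 i))) ->
  prodD z x = \prod_(i < d) (if x i then p 0 i else 1 - p 0 i).
Proof.
move=> hp hz; rewrite /prodD /dotc expR_sum -prodf_div.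
apply: eq_bigr => i _; have /andP[p0 p1] := hp i.
have q0 : 0 < 1 - p 0 i by rewrite subr_gt0.
have Eq : expR (z 0 i) = p 0 i / (1 - p 0 i).
  by rewrite hz lnK // posrE divr_gt0.
have E1 : 1 + expR (z 0 i) = (1 - p 0 i)^-1.
  by rewrite Eq -[X in X + _](divff (lt0r_neq0 q0)) -mulrDl subrK mul1r.
rewrite E1 invrK; case: (x i); rewrite ?mulr1 ?mulr0 ?expR0 ?mul1r //.
by rewrite Eq divfK // lt0r_neq0.
Qed.

End Distributions.

(* A structured real-RAM with a sampler and a membership oracle.  Programs are finite syntax, independent of the
   dimension and of every real parameter; their only constants are natural
   numbers.  Natural-number registers (with addition and truncated
   subtraction) serve as counters and addresses into a memory of real cells;
   arithmetic, [exp], [ln] and comparisons of reals are exact and have unit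
   cost. *)

Inductive iexp :=
| INum of nat
| IReg of nat
| IAdd of iexp & iexp
| ISub of iexp & iexp.

Inductive rexp :=
| RNat of iexp
| RCell of iexp
| RAdd of rexp & rexp
| RSub of rexp & rexp
| RMul of rexp & rexp
| RDiv of rexp & rexp
| RExp of rexp
| RLn of rexp.

Inductive bexp :=
| BLeqI of iexp & iexp
| BLtR of rexp & rexp
| BNot of bexp.

(* [Coin r e]: register [r] receives a fresh Bernoulli bit of parameter [e],
   clamped to [0, 1].
   [Sample a]: cells [a .. a + d - 1] receive a fresh independent sample.
   [Query r a]: register [r] receives the oracle's answer on the point
   encoded by cells [a .. a + d - 1], a nonzero cell standing for the bit 1. *)
Inductive com :=
| Skip
| Seq of com & com
| If of bexp & com & com
| While of bexp & com
| SetI of nat & iexp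
| SetR of iexp & rexp
| Coin of nat & rexp
| Sample of iexp
| Query of nat & iexp.

Section Semantics.
Context {R : realType}.

(* Finitely supported distributions as lists of weighted outcomes. *)
Definition fdist (A : Type) := seq (R * A).

Definition fret A (a : A) : fdist A := [:: (1, a)].

Definition fbind A B (D : fdist A) (f : A -> fdist B) : fdist B :=
  flatten [seq [seq (o.1 * o'.1, o'.2) | o' <- f o.2] | o <- D].

Definition prob A (D : fdist A) (E : A -> bool) : R :=
  \sum_(o <- D) o.1 * (E o.2)%:R.

Record state := State {
  reg : nat -> nat;
  mem : nat -> R;
  nsamples : nat;
  nqueries : nat }.

Definition upd A (f : nat -> A) (k : nat) (a : A) : nat -> A :=
  fun j => if j == k then a else f j.

Fixpoint ieval (s : state) (e : iexp) : nat :=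
  match e with
  | INum n => n
  | IReg r => reg s r
  | IAdd e1 e2 => (ieval s e1 + ieval s e2)%N
  | ISub e1 e2 => (ieval s e1 - ieval s e2)%N
  end.

Fixpoint reval (s : state) (e : rexp) : R :=
  match e with
  | RNat e1 => (ieval s e1)%:R
  | RCell e1 => mem s (ieval s e1)
  | RAdd e1 e2 => reval s e1 + reval s e2
  | RSub e1 e2 => reval s e1 - reval s e2
  | RMul e1 e2 => reval s e1 * reval s e2
  | RDiv e1 e2 => reval s e1 / reval s e2
  | RExp e1 => expR (reval s e1)
  | RLn e1 => ln (reval s e1)
  end.

Fixpoint beval (s : state) (b : bexp) : bool :=
  match b with
  | BLeqI e1 e2 => (ieval s e1 <= ieval s e2)%N
  | BLtR e1 e2 => reval s e1 < reval s e2
  | BNot b1 => ~~ beval s b1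
  end.

Section Execution.
Context {d : nat}.
Variables (q : cube d -> R) (S : {set cube d}).

Definition write_cube (m : nat -> R) (a : nat) (x : cube d) : nat -> R :=
  fun j => if (a <= j)%N then
             oapp (fun i : 'I_d => (x i)%:R) (m j) (insub (j - a)%N)
           else m j.

Definition read_cube (m : nat -> R) (a : nat) : cube d :=
  [ffun i : 'I_d => m (a + i)%N != 0].

(* The list is the control stack of commands still to be executed. *)
Definition config := (seq com * state)%type.

Definition step (cf : config) : fdist config :=
  let: (l, s) := cf in
  let: State rg m ns nq := s in
  match l with
  | [::] => fret cf
  | c :: k =>
    match c with
    | Skip => fret (k, s)
    | Seq c1 c2 => fret (c1 :: c2 :: k, s)
    | If b c1 c2 => fret ((if beval s b then c1 else c2) :: k, s)
    | While b c1 =>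
        fret (if beval s b then (c1 :: While b c1 :: k, s) else (k, s))
    | SetI r e => fret (k, State (upd rg r (ieval s e)) m ns nq)
    | SetR a e => fret (k, State rg (upd m (ieval s a) (reval s e)) ns nq)
    | Coin r e =>
        let p := Num.max 0 (Num.min 1 (reval s e)) in
        [:: (p, (k, State (upd rg r 1%N) m ns nq));
            (1 - p, (k, State (upd rg r 0%N) m ns nq))]
    | Sample a =>
        [seq (q x, (k, State rg (write_cube m (ieval s a) x) ns.+1 nq))
           | x <- enum (cube d)]
    | Query r a =>
        fret (k, State (upd rg r (read_cube m (ieval s a) \in S)) m ns nq.+1)
    end
  end.

Fixpoint exec (t : nat) (cf : config) : fdist config :=
  if t is t'.+1 then fbind (step cf) (exec t') else fret cf.

End Execution.

Definition halted (cf : config) : bool := nilp cf.1.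

(* Input: the dimension in register 0 and the real parameters in cells
   0, 1, 2, everything else being 0. *)
Definition init (A : com) (d : nat) (eps alpha lambda : R) : config :=
  ([:: A], State (upd (fun=> 0%N) 0 d)
                 (fun j => nth 0 [:: eps; alpha; lambda] j) 0 0).

Definition output (d : nat) (cf : config) : 'rV[R]_d :=
  \row_(i < d) mem cf.2 i.

(* poly(1/alpha)^poly(1/lambda) * C (d/eps^2) polylog(d/eps^2); the shift by 2
   keeps the logarithm bounded away from 0 when d/eps^2 is small. *)
Definition sample_bound (P Q : {poly R}) (C : R) (k d : nat)
    (eps alpha lambda : R) : R :=
  let n := d%:R / eps ^+ 2 in
  P.[alpha^-1] `^ Q.[lambda^-1] * (C * n * ln (2 + n) ^+ k).

End Semantics.

(* Main.v *)
(* Multiplied by D(z; S), the gradient of the negative log-likelihood of the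
   truncated model at z is the mean of 1_S(x) (x - y) for independent x ~ D(z)
   and y ~ D_S(zs), so one coin-tossed point, one truncated sample and one query
   give an unbiased estimate, without rejection sampling.  With w = z - zs,
   X = w.x and m = E_{D_S(zs)} X, its inner product with w is a multiple of
   E_{D_S(zs)} [(e^X - e^m) (X - m)], and anti-concentration together with
   Cauchy-Schwarz bounds it below by sigma |w|^2, where 1/sigma is
   exponential in H(w) = sum_i (sqrt (1 + w_i^2) - 1).

   The vector of logits of the means of D_S(zs) satisfies
   H(logit mu - zs) <= 16 ln(1/alpha)/lambda, by Jensen's inequality.  It is
   essential to measure this in H: the Euclidean distance can be of order
   ln(1/alpha), and on a ball of that radius 1/sigma would be exponential in
   ln(1/alpha)^2.  So the estimator takes the logits a of the (clamped) empirical
   means as a starting point and runs stochastic gradient descent; whenever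
   H(z - a) exceeds 2 R, with R >= H(zs - a), it makes a gradient step on H(z - a)
   instead, which decreases |z - zs|.  With step size 1/(sigma t) the quantity
   t^2 E |z_t - zs|^2 grows by O(d/sigma^2) per step, hence
   E |z_t - zs|^2 = O(d/(sigma^2 t)).  If eps >= 2 R, the starting point
   is already accurate enough. *)

Require Import Defs.
From mathcomp Require Import all_boot all_order all_algebra.
From mathcomp Require Import reals exp.
From mathcomp Require Import boolp sequences.
From mathcomp Require Import ring lra zify.
Set Implicit Arguments.
Unset Strict Implicit.
Unset Printing Implicit Defensive.
Import Order.TTheory GRing.Theory Num.Theory.
Local Open Scope ring_scope.

(** * The pseudo-Huber function and scalar inequalities *)

Section PseudoHuber.
Context {R : realType}.
Implicit Types t u v w : R.

(** The Japanese bracket; [hub] is the pseudo-Huber function, quadratic near 0 and linear at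
    infinity. *)
Definition jap t : R := Num.sqrt (1 + t ^+ 2).
Definition hub t : R := jap t - 1.

Lemma jap_sq t : jap t ^+ 2 = 1 + t ^+ 2.
Proof. by rewrite sqr_sqrtr // addr_ge0 ?sqr_ge0. Qed.

Lemma jap_ge1 t : 1 <= jap t.
Proof.
have t2 := sqr_ge0 t; have s0 : 0 <= jap t := sqrtr_ge0 _.
by have := jap_sq t; nra.
Qed.

Lemma jap_ge_norm t : `|t| <= jap t.
Proof.
have s1 := jap_ge1 t; have := jap_sq t; rewrite -(real_normK (num_real t)).
by have := normr_ge0 t; nra.
Qed.

(** The machine has [exp] and [ln] but no square root, so the program computes [jap] through this
    identity. *)
Lemma jap_exp t : jap t = expR (ln (1 + t ^+ 2) / 2).
Proof.
have p : 0 < 1 + t ^+ 2 by have := sqr_ge0 t; nra.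
rewrite /jap -[1 + t ^+ 2 in LHS]lnK ?posrE //.
set y := ln _; have -> : y = y / 2 + y / 2 by field.
rewrite expRD -expr2 sqrtr_sqr ger0_norm ?expR_ge0 //.
by congr expR; field.
Qed.

Lemma hub_ge0 t : 0 <= hub t.
Proof. by rewrite subr_ge0 jap_ge1. Qed.

Lemma hub_sq t : t ^+ 2 = hub t ^+ 2 + 2 * hub t.
Proof. by have := jap_sq t; rewrite /hub; nra. Qed.

Lemma hubN t : hub (- t) = hub t.
Proof. by rewrite /hub /jap sqrrN. Qed.

Lemma hub_le_sq t : hub t <= t ^+ 2 / 2.
Proof. by have := hub_sq t; have := sqr_ge0 (hub t); lra. Qed.

Lemma hub_tangent u v : hub u - hub v <= u / jap u * (u - v).
Proof.
have s1 := jap_ge1 u; have t1 := jap_ge1 v.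
have s2 := jap_sq u; have t2 := jap_sq v.
(* Multiplied by [jap u], the tangent inequality is Cauchy-Schwarz for the plane vectors [(1, u)]
   and [(1, v)]. *)
have cs : 1 + u * v <= jap u * jap v.
  rewrite leNgt; apply/negP => lt.
  have st : 0 <= jap u * jap v by nra.
  have e : (jap u * jap v) ^+ 2 = (1 + u * v) ^+ 2 + (u - v) ^+ 2.
    by rewrite exprMn s2 t2; ring.
  by have := sqr_ge0 (u - v); nra.
rewrite mulrAC ler_pdivlMr; last by nra.
by rewrite /hub; nra.
Qed.

(** The derivative of [hub] is self-bounding: its square is controlled by [hub] itself. This pays
    for the second-order term of a gradient step. *)
Lemma hub_grad u : (u / jap u) ^+ 2 <= 2 * hub u.
Proof.
have s1 := jap_ge1 u; have s2 := jap_sq u.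
rewrite expr_div_n ler_pdivrMr; last by nra.
rewrite /hub; have : 0 <= (jap u - 1) ^+ 2 by apply: sqr_ge0.
nra.
Qed.

Lemma hub_double u : hub (2 * u) <= 4 * hub u.
Proof.
have s1 := jap_ge1 u; have s2 := jap_sq u.
have t1 := jap_ge1 (2 * u); have t2 := jap_sq (2 * u).
rewrite /hub leNgt; apply/negP => lt.
have p : 0 <= (jap u - 1) ^+ 2 by apply: sqr_ge0.
have lt' : 4 * jap u - 3 < jap (2 * u) by lra.
have : (4 * jap u - 3) ^+ 2 < jap (2 * u) ^+ 2 by nra.
by rewrite t2; nra.
Qed.

(** Since [u + v] is the midpoint of [2 * u] and [2 * v], convexity and the doubling bound suffice;
    the two tangent terms cancel. *)
Lemma hubD u v : hub (u + v) <= 2 * hub u + 2 * hub v.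
Proof.
have := hub_tangent (u + v) (2 * u); have := hub_tangent (u + v) (2 * v).
have := hub_double u; have := hub_double v.
set g := _ / jap _ => h1 h2 h3 h4.
have e : g * (u + v - 2 * u) + g * (u + v - 2 * v) = 0 by ring.
lra.
Qed.

End PseudoHuber.

(** * Exponential inequalities and Bernoulli moment generating functions *)

Section ScalarBounds.
Context {R : realType}.
Implicit Types t u v w z mu lam : R.

Lemma cosh_le_exp_norm t : expR t + expR (- t) <= 2 * expR `|t|.
Proof.
have h1 : expR t <= expR `|t| by rewrite ler_expR ler_norm.
have h2 : expR (- t) <= expR `|t| by rewrite ler_expR -normrN ler_norm.
lra.
Qed.

Lemma cosh_le_exp_sq t : expR t + expR (- t) <= 2 * expR (2 * t ^+ 2).
Proof.
have [ht|ht] := leP `|t| (1 / 2); last first.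
  apply: le_trans (cosh_le_exp_norm t) _.
  rewrite ler_pM2l // ler_expR -(real_normK (num_real t)); nra.
have /andP[h1 h2] : - (1/2) <= t <= 1/2 by rewrite -ler_norml.
have key (s : R) : -(1/2) <= s <= 1/2 -> expR s <= (1 - s)^-1.
  move=> /andP[s1 s2]; rewrite -[s in expR s]opprK expRN lef_pV2 ?posrE ?expR_gt0 //.
    by have := expR_ge1Dx (- s).
  by lra.
have k1 := key t; have k2 := key (- t).
have t2 : t ^+ 2 <= 1 / 4 by nra.
have e : (1 - t)^-1 + (1 - - t)^-1 = 2 / (1 - t ^+ 2).
  by field; rewrite !lt0r_neq0 //; nra.
have f : (1 - t ^+ 2)^-1 <= 1 + 2 * t ^+ 2.
  by rewrite -div1r ler_pdivrMr; nra.
have := expR_ge1Dx (2 * t ^+ 2).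
have := k1 _; have := k2 _; lra.
Qed.

(** The left side is the square of [cosh (w / 2)]. It is bounded by the exponential of a quadratic
    for small [w] and of a linear function for large [w]; [3 * hub w] dominates both. *)
Lemma cosh_le_exp_hub w :
  (2 + expR w + expR (- w)) / 4 <= expR (3 * hub w).
Proof.
set y := w / 2.
have -> : (2 + expR w + expR (- w)) / 4 = ((expR y + expR (- y)) / 2) ^+ 2.
  have -> : w = y + y by rewrite /y; field.
  rewrite opprD !expRD expRN; field.
  by rewrite lt0r_neq0 // expR_gt0.
have p : 0 <= (expR y + expR (- y)) / 2.
  by have := expR_gt0 y; have := expR_gt0 (- y); lra.
have s1 := jap_ge1 w; have s2 := jap_sq w.
have E a : (expR y + expR (- y)) / 2 <= expR a -> 2 * a <= 3 * hub w ->
    ((expR y + expR (- y)) / 2) ^+ 2 <= expR (3 * hub w).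
  move=> ha hb; apply: (@le_trans _ _ (expR (2 * a))); last by rewrite ler_expR.
  have -> : 2 * a = a + a by ring.
  rewrite expRD -expr2 lerXn2r // ?nnegrE ?expR_ge0 //.
have n0 := normr_ge0 w; have n2 : `|w| ^+ 2 = w ^+ 2 by rewrite real_normK ?num_real.
have [h|h] := leP `|w| 1.
  apply: (E (2 * y ^+ 2)); first by have := cosh_le_exp_sq y; lra.
  have s4 : jap w <= 2 by nra.
  rewrite /hub; have -> : 2 * (2 * y ^+ 2) = w ^+ 2 by rewrite /y; field.
  nra.
apply: (E `|y|); first by have := cosh_le_exp_norm y; lra.
have -> : `|y| = `|w| / 2 by rewrite /y normrM [`|2^-1|]ger0_norm //; lra.
by have := jap_ge_norm w; rewrite /hub; nra.
Qed.

Lemma softplus_second_diff z w :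
  (1 + expR (z + w)) * (1 + expR (z - w)) <= (1 + expR z) ^+ 2 * expR (3 * hub w).
Proof.
have ez := expR_gt0 z; have ew := expR_gt0 w; have ew' := expR_gt0 (- w).
apply: (@le_trans _ _ ((1 + expR z) ^+ 2 * ((2 + expR w + expR (- w)) / 4))); last first.
  by rewrite ler_pM2l ?cosh_le_exp_hub // exprn_gt0 //; lra.
rewrite !expRD.
have e : expR w * expR (- w) = 1 by rewrite -expRD subrr expR0.
have h2 : 2 <= expR w + expR (- w) by have := sqr_ge0 (expR w - expR (- w)); nra.
(* This is the exact difference of the two sides: the ratio of the products is largest at
   [z = 0]. *)
have : 0 <= (1 - expR z) ^+ 2 * (expR w + expR (- w) - 2) / 4.
  by apply: divr_ge0 => //; apply: mulr_ge0; [exact: sqr_ge0|lra].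
nra.
Qed.

(** The square of [1 + t / 2 <= expR (t / 2)]; [-1 <= t] keeps the left side nonnegative. *)
Lemma expR_ge_quad t : -1 <= t -> 1 + t + t ^+ 2 / 4 <= expR t.
Proof.
move=> ht; have -> : t = t / 2 + t / 2 by field.
by rewrite expRD; have := expR_ge1Dx (t / 2); nra.
Qed.

Lemma expR_le_lin t : 0 <= t <= 1 -> expR (t / 2) <= 1 + t.
Proof.
move=> /andP[t0 t1]; rewrite -[t / 2]opprK expRN.
rewrite -[1 + t]invrK lef_pV2 ?posrE ?expR_gt0 ?invr_gt0 //; last by lra.
apply: le_trans (expR_ge1Dx _); rewrite -div1r ler_pdivrMr; nra.
Qed.

(** Jensen's inequality for the power function on a two-point law. In the induction step the defect
    is [mu * (1 - mu)] times a product of two factors of equal sign. *)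
Lemma convex_pow mu y n : 0 <= mu <= 1 -> 0 <= y ->
  ((1 - mu) + mu * y) ^+ n <= (1 - mu) + mu * y ^+ n.
Proof.
move=> /andP[m0 m1] y0; elim: n => [|n IH]; first by rewrite !expr0; lra.
rewrite exprS; apply: (@le_trans _ _ (((1 - mu) + mu * y) * ((1 - mu) + mu * y ^+ n))).
  by apply: ler_wpM2l => //; nra.
rewrite exprS -subr_ge0.
have -> : 1 - mu + mu * (y * y ^+ n) - (1 - mu + mu * y) * (1 - mu + mu * y ^+ n)
  = mu * (1 - mu) * ((y - 1) * (y ^+ n - 1)) by ring.
apply: mulr_ge0; first by apply: mulr_ge0; lra.
have [h|h] := leP 1 y.
  by rewrite mulr_ge0 ?subr_ge0 ?exprn_ege1.
by rewrite mulr_le0 ?subr_le0 ?exprn_ile1 // ltW.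
Qed.

(** The expectation of [expR (w * (mu - B))] for a Bernoulli variable [B] of mean [mu]. *)
Definition bern_mgf mu w : R := (1 - mu) * expR (mu * w) + mu * expR (- ((1 - mu) * w)).

Lemma bern_mgfE mu w : bern_mgf mu w = expR (mu * w) * ((1 - mu) + mu * expR (- w)).
Proof.
rewrite /bern_mgf; have -> : - ((1 - mu) * w) = mu * w + - w by ring.
by rewrite expRD; ring.
Qed.

(** Centring cancels the first-order terms; what remains is a quarter of the variance
    [mu * (1 - mu)], which is at least [lam / 2]. *)
Lemma bern_mgf_small mu lam w : 0 < lam -> lam <= mu <= 1 - lam -> `|w| <= 1 ->
  expR (lam / 16 * w ^+ 2) <= bern_mgf mu w.
Proof.
move=> l0 /andP[m1 m2] hw.
have /andP[w1 w2] : -1 <= w <= 1 by rewrite -ler_norml.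
have q1 : -1 <= mu * w by nra.
have q2 : -1 <= - ((1 - mu) * w) by nra.
have := expR_ge_quad q1; have := expR_ge_quad q2.
have w2' : w ^+ 2 <= 1 by nra.
have wp := sqr_ge0 w.
have := @expR_le_lin (lam / 8 * w ^+ 2).
have -> : lam / 8 * w ^+ 2 / 2 = lam / 16 * w ^+ 2 by field.
move=> /(_ _) h1 h2 h3.
have h1' : expR (lam / 16 * w ^+ 2) <= 1 + lam / 8 * w ^+ 2 by apply: h1; nra.
have hm : lam / 2 <= mu * (1 - mu) by nra.
rewrite /bern_mgf; apply: le_trans h1' _.
have h : (1 - mu) * (1 + mu * w + (mu * w) ^+ 2 / 4) +
  mu * (1 + - ((1 - mu) * w) + (- ((1 - mu) * w)) ^+ 2 / 4) =
  1 + mu * (1 - mu) / 4 * w ^+ 2 by field.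
have : (1 - mu) * (1 + mu * w + (mu * w) ^+ 2 / 4) <= (1 - mu) * expR (mu * w).
  by apply: ler_wpM2l => //; lra.
have : mu * (1 + - ((1 - mu) * w) + (- ((1 - mu) * w)) ^+ 2 / 4) <= mu * expR (- ((1 - mu) * w)).
  by apply: ler_wpM2l => //; lra.
nra.
Qed.

Lemma bern_mgf_ge_hub mu lam w : 0 < lam -> lam <= mu <= 1 - lam ->
  expR (lam / 16 * hub w) <= bern_mgf mu w.
Proof.
(* With w = n u and |u| <= 1, convexity turns the quadratic bound at u into a
   bound linear in |w|. *)
move=> l0 hm; have /andP[m1 m2] := hm.
set n := (Num.truncn `|w|).+1.
have n0 : 0 < n%:R :> R by rewrite ltr0n.
have hn : `|w| < n%:R by apply: truncnS_gt.
have hn' : n%:R <= 1 + `|w| by rewrite /n -natr1 addrC lerD2l truncn_le.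
pose u := w / n%:R.
have ew : w = n%:R * u by rewrite /u mulrC divfK // gt_eqF.
have hu : `|u| <= 1.
  by rewrite /u normrM normfV [`|n%:R|]gtr0_norm // ler_pdivrMr // mul1r ltW.
have mgp v : 0 <= bern_mgf mu v.
  by rewrite /bern_mgf addr_ge0 // mulr_ge0 ?expR_ge0 //; lra.
apply: (@le_trans _ _ (bern_mgf mu u ^+ n)).
  apply: (@le_trans _ _ (expR (lam / 16 * u ^+ 2) ^+ n)).
    rewrite -expRM_natl ler_expR mulrCA ler_pM2l; last by lra.
    have -> : n%:R * u ^+ 2 = w ^+ 2 / n%:R by rewrite ew; field; rewrite gt_eqF.
    rewrite ler_pdivlMr // /hub.
    have := jap_ge_norm w; have := jap_ge1 w; have := jap_sq w; nra.
  by rewrite lerXn2r ?nnegrE ?expR_ge0 // bern_mgf_small.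
rewrite !bern_mgfE exprMn -expRM_natl ew mulrCA.
rewrite ler_pM2l ?expR_gt0 //.
apply: le_trans (convex_pow _ _ (expR_ge0 _)) _; first by lra.
by rewrite -expRM_natl mulrN.
Qed.

Lemma ln_ratio_le u v c : 0 < c -> c <= u -> c <= v -> `|ln u - ln v| <= `|u - v| / c.
Proof.
move=> c0; wlog h : u v / v <= u => [H|] cu cv.
  have [h|h] := leP v u; first exact: H.
  by rewrite distrC [`|u - v|]distrC; apply: H => //; apply: ltW.
have v0 : 0 < v by lra.
have u0 : 0 < u by lra.
rewrite !ger0_norm ?subr_ge0 // ?ler_ln ?posrE //.
rewrite -ln_div ?posrE //.
have -> : u / v = 1 + (u - v) / v by field; rewrite gt_eqF.
apply: le_trans (le_ln1Dx _) _; last first.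
  by rewrite ler_wpM2l ?subr_ge0 // lef_pV2.
by rewrite (lt_le_trans (ltrN10 _)) // divr_ge0 ?subr_ge0 // ltW.
Qed.

Definition logit u : R := ln (u / (1 - u)).

Lemma logit_lip lam u v : 0 < lam -> lam <= u <= 1 - lam -> lam <= v <= 1 - lam ->
  `|logit u - logit v| <= 2 / lam * `|u - v|.
Proof.
move=> l0 /andP[u1 u2] /andP[v1 v2].
rewrite /logit !ln_div ?posrE; try lra.
have := @ln_ratio_le u v lam l0 u1 v1.
have := @ln_ratio_le (1 - v) (1 - u) lam l0.
have -> : 1 - v - (1 - u) = u - v by ring.
move=> /(_ _ _) h1 h2.
have -> : ln u - ln (1 - u) - (ln v - ln (1 - v)) =
          (ln u - ln v) + (ln (1 - v) - ln (1 - u)) by ring.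
apply: le_trans (ler_normD _ _) _.
have h1' := h1 _ _.
have -> : 2 / lam * `|u - v| = `|u - v| / lam + `|u - v| / lam by ring.
by apply: lerD h2 (h1 _ _); lra.
Qed.

(** A strong monotonicity of [expR]. The denominator uses negative exponents so that its average
    will be a moment generating function at [- w]. *)
Lemma expR_monotone_quad u v :
  (u - v) ^+ 2 / (expR (- u) + expR (- v)) <= (expR u - expR v) * (u - v).
Proof.
wlog h : u v / v <= u => [H|].
  have [h|h] := leP v u; first exact: H.
  have := H _ _ (ltW h).
  have -> : (v - u) ^+ 2 = (u - v) ^+ 2 by ring.
  have -> : (expR v - expR u) * (v - u) = (expR u - expR v) * (u - v) by ring.
  by rewrite [expR (- v) + _]addrC.
have eu := expR_gt0 (- u); have ev := expR_gt0 (- v); have ev' := expR_gt0 v.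
rewrite ler_pdivrMr; last by lra.
have h1 : (u - v) * expR v <= expR u - expR v.
  have -> : expR u = expR v * expR (u - v) by rewrite -expRD addrC subrK.
  by have := expR_ge1Dx (u - v); nra.
have e : expR v * expR (- v) = 1 by rewrite -expRD subrr expR0.
have d0 : 0 <= u - v by lra.
have h2 : (u - v) ^+ 2 * (expR v * expR (- v)) <= (expR u - expR v) * (u - v) * expR (- v).
  by rewrite mulrA; apply: ler_wpM2r; [exact: ltW|nra].
have h3 : 0 <= (expR u - expR v) * (u - v) * expR (- u).
  have d1 : 0 <= expR u - expR v by nra.
  by apply: mulr_ge0; [apply: mulr_ge0|exact: ltW].
by move: h2; rewrite e; lra.
Qed.

End ScalarBounds.

(** * Exponential families on the cube *)

(** Cauchy-Schwarz in the form with denominators, obtained by summing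
    [2 * t * f - t ^+ 2 * a <= f ^+ 2 / a] at the optimal [t = F / A]. *)
Lemma sqr_sum_le (R : realFieldType) (I : finType) (P : pred I) (f a : I -> R) (A : R) :
  0 < A -> (forall i, P i -> 0 < a i) -> \sum_(i | P i) a i <= A ->
  (\sum_(i | P i) f i) ^+ 2 <= A * \sum_(i | P i) f i ^+ 2 / a i.
Proof.
move=> A0 a0 hA; set F := \sum_(i | P i) f i; pose t := F / A.
have h : \sum_(i | P i) (2 * t * f i - t ^+ 2 * a i) <= \sum_(i | P i) f i ^+ 2 / a i.
  apply: ler_sum => i Pi; have ai := a0 i Pi.
  rewrite ler_pdivlMr // -subr_ge0.
  have -> : f i ^+ 2 - (2 * t * f i - t ^+ 2 * a i) * a i = (f i - t * a i) ^+ 2 by ring.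
  exact: sqr_ge0.
rewrite mulrC -ler_pdivrMr //; apply: le_trans h.
rewrite sumrB -!mulr_sumr -/F.
have ht : F = t * A by rewrite /t divfK // gt_eqF.
have -> : F ^+ 2 / A = t * F by rewrite /t; ring.
by have := sqr_ge0 t; rewrite {2}ht; nra.
Qed.

Section CubeAnalysis.
Context {R : realType} {d : nat}.
Implicit Types (z w v : 'rV[R]_d) (x : cube d) (S : {set cube d}).

Definition dotr w v : R := \sum_(i < d) w 0 i * v 0 i.
Definition sqn w : R := \sum_(i < d) w 0 i ^+ 2.
Definition Hub w : R := \sum_(i < d) hub (w 0 i).
Definition bits x : 'rV[R]_d := \row_i (x i)%:R.

Lemma dotcE w x : dotc w x = dotr w (bits x).
Proof. by apply: eq_bigr => i _; rewrite mxE. Qed.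

Lemma dotcD w v x : dotc (w + v) x = dotc w x + dotc v x.
Proof. by rewrite -big_split; apply: eq_bigr => i _; rewrite mxE mulrDl. Qed.

Lemma dotcZ (c : R) w x : dotc (c *: w) x = c * dotc w x.
Proof. by rewrite mulr_sumr; apply: eq_bigr => i _; rewrite mxE mulrA. Qed.

Lemma dotcN w x : dotc (- w) x = - dotc w x.
Proof. by rewrite -scaleN1r dotcZ mulN1r. Qed.

Lemma sqn_ge0 w : 0 <= sqn w.
Proof. by apply: sumr_ge0 => i _; apply: sqr_ge0. Qed.

Lemma sqnN w : sqn (- w) = sqn w.
Proof. by apply: eq_bigr => i _; rewrite mxE sqrrN. Qed.

Lemma sqn_eq0 w : sqn w = 0 -> w = 0.
Proof.
move=> /eqP; rewrite psumr_eq0 => [/allP h|i _]; last exact: sqr_ge0.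
apply/rowP => i; rewrite mxE; apply/eqP; rewrite -sqrf_eq0.
by apply: h; rewrite mem_index_enum.
Qed.

Lemma sqnDe w v : sqn (w + v) = sqn w + 2 * dotr w v + sqn v.
Proof.
rewrite /sqn /dotr mulr_sumr -!big_split; apply: eq_bigr => i _.
by rewrite mxE /=; ring.
Qed.

Lemma sqnZ (c : R) w : sqn (c *: w) = c ^+ 2 * sqn w.
Proof. by rewrite mulr_sumr; apply: eq_bigr => i _; rewrite mxE exprMn. Qed.

Lemma sqnD w v : sqn (w + v) <= 2 * sqn w + 2 * sqn v.
Proof.
rewrite /sqn !mulr_sumr -big_split; apply: ler_sum => i _ /=.
by rewrite mxE; have := sqr_ge0 (w 0 i - v 0 i); nra.
Qed.

Lemma Hub_ge0 w : 0 <= Hub w.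
Proof. by apply: sumr_ge0 => i _; apply: hub_ge0. Qed.

Lemma HubN w : Hub (- w) = Hub w.
Proof. by apply: eq_bigr => i _; rewrite mxE hubN. Qed.

Lemma HubD w v : Hub (w + v) <= 2 * Hub w + 2 * Hub v.
Proof.
rewrite /Hub !mulr_sumr -big_split; apply: ler_sum => i _ /=.
by rewrite mxE hubD.
Qed.

Lemma Hub_le_sqn w : Hub w <= sqn w / 2.
Proof. by rewrite mulr_suml; apply: ler_sum => i _; apply: hub_le_sq. Qed.

(** Termwise [t ^+ 2 = hub t ^+ 2 + 2 * hub t], and a sum of squares of nonnegative numbers is at
    most the square of their sum. *)
Lemma sqn_le_Hub w : sqn w <= Hub w ^+ 2 + 2 * Hub w.
Proof.
have -> : sqn w = \sum_i hub (w 0 i) ^+ 2 + 2 * Hub w.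
  by rewrite mulr_sumr -big_split; apply: eq_bigr => i _; rewrite /= hub_sq.
rewrite lerD2r expr2 {2}/Hub mulr_sumr; apply: ler_sum => i _.
rewrite expr2 ler_wpM2r ?hub_ge0 // /Hub (bigD1 i) //= lerDl.
by apply: sumr_ge0 => j _; apply: hub_ge0.
Qed.

Lemma sum_cube_prod (F : 'I_d -> bool -> R) :
  \sum_(x : cube d) \prod_(i < d) F i (x i) = \prod_(i < d) (F i true + F i false).
Proof.
rewrite -bigA_distr_bigA; apply: eq_bigr => i _.
by rewrite -big_bool.
Qed.

Lemma sum_exp_dotc z :
  \sum_(x : cube d) expR (dotc z x) = \prod_(i < d) (1 + expR (z 0 i)).
Proof.
under eq_bigr do rewrite /dotc expR_sum.
rewrite (sum_cube_prod (fun i b => expR (z 0 i * b%:R))).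
by apply: eq_bigr => i _; rewrite mulr1 mulr0 expR0 addrC.
Qed.

Lemma partition_gt0 z : 0 < \prod_(i < d) (1 + expR (z 0 i)).
Proof. by apply: prodr_gt0 => i _; have := expR_gt0 (z 0 i); lra. Qed.

Lemma prodD_gt0 z x : 0 < prodD z x.
Proof. by rewrite /prodD divr_gt0 ?expR_gt0 ?partition_gt0. Qed.

Lemma prodD_sum1 z : \sum_(x : cube d) prodD z x = 1.
Proof. by rewrite -mulr_suml sum_exp_dotc divff // gt_eqF // partition_gt0. Qed.

Definition sigmoid (t : R) : R := expR t / (1 + expR t).

Lemma sigmoid_bounds t : 0 < sigmoid t < 1.
Proof.
have e := expR_gt0 t; rewrite /sigmoid divr_gt0 ?addr_gt0 //=.
by rewrite ltr_pdivrMr ?mul1r; lra.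
Qed.

Lemma prodD_sigmoid z x :
  prodD z x = \prod_(i < d) (if x i then sigmoid (z 0 i) else 1 - sigmoid (z 0 i)).
Proof.
rewrite (@prodD_bernoulli R d (\row_i sigmoid (z 0 i)) z x).
- by apply: eq_bigr => i _; rewrite mxE.
- by move=> i; rewrite mxE sigmoid_bounds.
move=> i; rewrite mxE -[LHS]expRK; congr ln.
have e := expR_gt0 (z 0 i); rewrite /sigmoid; field.
by apply/andP; split; rewrite lt0r_neq0 //; lra.
Qed.

Definition mgf z w : R := \sum_(x : cube d) prodD z x * expR (dotc w x).

Lemma mgfE z w : mgf z w = \prod_(i < d) ((1 + expR (z 0 i + w 0 i)) / (1 + expR (z 0 i))).
Proof.
rewrite prodf_div /mgf /prodD.
under [LHS]eq_bigr => x _ do rewrite mulrAC -expRD -dotcD.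
rewrite -mulr_suml sum_exp_dotc; congr (_ / _).
by apply: eq_bigr => i _; rewrite mxE.
Qed.

Lemma mgf_gt0 z w : 0 < mgf z w.
Proof.
rewrite mgfE; apply: prodr_gt0 => i _.
by rewrite divr_gt0 // addr_gt0 ?expR_gt0.
Qed.

Lemma prodD_tilt z w x : prodD (z + w) x = prodD z x * expR (dotc w x) / mgf z w.
Proof.
rewrite mgfE prodf_div /prodD dotcD expRD.
have -> : \prod_(i < d) (1 + expR ((z + w) 0 i)) = \prod_(i < d) (1 + expR (z 0 i + w 0 i)).
  by apply: eq_bigr => i _; rewrite mxE.
have h : \prod_(i < d) (1 + expR (z 0 i + w 0 i)) != 0.
  apply/prodf_neq0 => i _; rewrite gt_eqF //.
  by have := expR_gt0 (z 0 i + w 0 i); lra.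
have h' : \prod_(i < d) (1 + expR (z 0 i)) != 0 by rewrite gt_eqF ?partition_gt0.
by field; apply/andP.
Qed.

(** The product is the exponential of a second difference of the log-partition function. First-order
    parts, which can make one factor exponential in the sum of the [|w_i|], cancel, and the bound is
    uniform in [z]. *)
Lemma mgf_mgfN z w : mgf z w * mgf z (- w) <= expR (3 * Hub w).
Proof.
rewrite !mgfE -big_split /Hub mulr_sumr expR_sum /=.
apply: ler_prod => i _; have e t : 0 < 1 + expR t :> R by have := expR_gt0 t; lra.
apply/andP; split; first by apply: mulr_ge0; apply: divr_ge0; rewrite ltW.
rewrite mxE; have := softplus_second_diff (z 0 i) (w 0 i).
rewrite mulrACA -invfM -expr2 ler_pdivrMr ?exprn_gt0 //.
by rewrite [expR (3 * _) * _]mulrC.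
Qed.

(** The left side is one plus the chi-square divergence of [prodD z] from [prodD (z + w)]. *)
Lemma chi2_prodD z w :
  \sum_(x : cube d) prodD z x ^+ 2 / prodD (z + w) x = mgf z w * mgf z (- w).
Proof.
rewrite {2}/mgf mulr_sumr; apply: eq_bigr => x _.
rewrite prodD_tilt dotcN expRN.
have p := prodD_gt0 z x; have m := mgf_gt0 z w; have e := expR_gt0 (dotc w x).
by field; rewrite !lt0r_neq0.
Qed.

Lemma l2norm_sqn w : l2norm w = Num.sqrt (sqn w). Proof. by []. Qed.

Lemma l2norm_le w (c : R) : 0 <= c -> sqn w <= c ^+ 2 -> l2norm w <= c.
Proof. by move=> c0 h; rewrite l2norm_sqn -(ger0_norm c0) -sqrtr_sqr ler_wsqrtr. Qed.

(** At distance at least 1/2 the claim is trivial, total variation being at most 1. Below that,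
    Cauchy-Schwarz bounds the L1 distance by the chi-square divergence, which is at most
    [3 * sqn w]. *)
Lemma dTV_prodD_le z z' : dTV (prodD z) (prodD z') <= 2 * l2norm (z - z').
Proof.
set w := z' - z; have ez : z' = z + w by rewrite /w addrC subrK.
have -> : l2norm (z - z') = Num.sqrt (sqn w).
  by rewrite l2norm_sqn /w -sqnN opprB.
set s := Num.sqrt _; have s0 : 0 <= s := sqrtr_ge0 _.
have s2 : s ^+ 2 = sqn w by rewrite sqr_sqrtr // sqn_ge0.
rewrite /dTV; set T := \sum_x _.
have T0 : 0 <= T by apply: sumr_ge0.
have T2 : T <= 2.
  have -> : 2 = \sum_x prodD z x + \sum_x prodD z' x by rewrite !prodD_sum1.
  rewrite -big_split; apply: ler_sum => x _; rewrite (le_trans (ler_normB _ _)) //.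
  by rewrite !gtr0_norm ?prodD_gt0.
have [hs|hs] := leP (1/2) s; first by lra.
have key : T ^+ 2 <= expR (3 * Hub w) - 1.
  apply: (@le_trans _ _ (1 * \sum_(x : cube d) `|prodD z x - prodD z' x| ^+ 2 / prodD z' x)).
    apply: sqr_sum_le => //; first by move=> x _; apply: prodD_gt0.
    by rewrite prodD_sum1.
  rewrite mul1r; under eq_bigr => x _.
    rewrite real_normK ?num_real //.
    have -> : (prodD z x - prodD z' x) ^+ 2 / prodD z' x =
      prodD z x ^+ 2 / prodD z' x - (2 * prodD z x - prodD z' x).
      by have := prodD_gt0 z' x => p; field; rewrite gt_eqF.
    over.
  rewrite sumrB {1}ez chi2_prodD sumrB -mulr_sumr !prodD_sum1.
  by have := mgf_mgfN z w; lra.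
have h : expR (3 * Hub w) <= 1 + 3 * sqn w.
  apply: le_trans (expR_le_lin _); last by rewrite -s2; nra.
  by rewrite ler_expR; have := Hub_le_sqn w; lra.
by nra.
Qed.

End CubeAnalysis.

(** As [s + w] is the logit of [mu], the right side is exactly [bern_mgf mu w]: one coordinate of
    the comparison in [Hub_logit_tmean]. *)
Lemma logit_bern_mgf (R : realType) (mu lam s w : R) :
  0 < lam -> lam <= mu <= 1 - lam -> w = logit mu - s ->
  expR (lam / 16 * hub w) <= expR (w * mu) * ((1 + expR (s + w)) / (1 + expR s))^-1.
Proof.
move=> l0 hm ew; have [m1 m2] := andP hm.
apply: le_trans (bern_mgf_ge_hub w l0 hm) _.
have -> : s + w = logit mu by rewrite ew; ring.
have -> : s = logit mu - w by rewrite ew; ring.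
have mp : 0 < mu / (1 - mu) by apply: divr_gt0; lra.
rewrite invf_div bern_mgfE [w * mu]mulrC expRD /logit lnK ?posrE //.
rewrite le_eqVlt; apply/orP; left; apply/eqP.
by field; apply/andP; split; rewrite lt0r_neq0 //; lra.
Qed.

(** * Truncated product distributions: location of the mean and strong monotonicity of the
    gradient *)

Section Truncated.
Context {R : realType} {d : nat}.
Implicit Types (z w v : 'rV[R]_d) (x : cube d).
Variables (S : {set cube d}) (zs : 'rV[R]_d) (alpha lambda : R).
Hypotheses (alpha0 : 0 < alpha) (lambda0 : 0 < lambda).
Hypothesis massS : alpha <= mass (prodD zs) S.
Hypothesis anti : anti_concentrated (prodD_trunc zs S) lambda.

Let q := prodD_trunc zs S.

Lemma mass_gt0 : 0 < mass (prodD zs) S.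
Proof. exact: lt_le_trans massS. Qed.

Lemma alpha_le1 : alpha <= 1.
Proof.
apply: le_trans massS _; rewrite -(prodD_sum1 zs) /mass.
by rewrite [leRHS](bigID (mem S)) /= lerDl sumr_ge0 // => x _; rewrite ltW ?prodD_gt0.
Qed.

Lemma trunc_ge0 x : 0 <= q x.
Proof. by rewrite /q /prodD_trunc; case: ifP => // _; rewrite divr_ge0 ?ltW ?prodD_gt0 ?mass_gt0. Qed.

Lemma sum_trunc (f : cube d -> R) :
  \sum_(x : cube d) q x * f x = (\sum_(x in S) prodD zs x * f x) / mass (prodD zs) S.
Proof.
rewrite mulr_suml [RHS]big_mkcond; apply: eq_bigr => x _.
by rewrite /q /prodD_trunc; case: ifP => _; rewrite ?mul0r // mulrAC.
Qed.

Lemma trunc_sum1 : \sum_(x : cube d) q x = 1.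
Proof.
under eq_bigr do rewrite -[q _]mulr1.
rewrite sum_trunc; under eq_bigr do rewrite mulr1.
by rewrite divff // gt_eqF // mass_gt0.
Qed.

Definition tmean : 'rV[R]_d := \row_i \sum_(x : cube d) q x * (x i)%:R.

Lemma dotr_tmean w : \sum_(x : cube d) q x * dotc w x = dotr w tmean.
Proof.
rewrite /dotr /dotc; under eq_bigr do rewrite mulr_sumr.
rewrite exchange_big; apply: eq_bigr => i _; rewrite mxE mulr_sumr.
by apply: eq_bigr => x _; ring.
Qed.

(** Jensen's inequality for the truncated law, via the tangent of [expR] at the mean; passing to the
    untruncated law costs the mass of [S]. *)
Lemma mgf_jensen w : alpha * expR (dotr w tmean) <= mgf zs w.
Proof.
set m := dotr w tmean.
have h : expR m <= \sum_(x : cube d) q x * expR (dotc w x).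
  have -> : expR m = \sum_(x : cube d) q x * (expR m * (1 + (dotc w x - m))).
    under eq_bigr do rewrite mulrCA mulrDr mulr1 mulrBr.
    rewrite -mulr_sumr big_split sumrB /= dotr_tmean -mulr_suml trunc_sum1 mul1r.
    by rewrite subrr addr0 mulr1.
  apply: ler_sum => x _; apply: ler_wpM2l; first exact: trunc_ge0.
  have -> : expR (dotc w x) = expR m * expR (dotc w x - m).
    by rewrite -expRD [m + _]addrC subrK.
  by rewrite ler_pM2l ?expR_gt0 // expR_ge1Dx.
have M := mass_gt0; have e := expR_ge0 m.
apply: (@le_trans _ _ (mass (prodD zs) S * expR m)); first exact: ler_wpM2r.
move: h; rewrite sum_trunc ler_pdivlMr // mulrC => /le_trans; apply.
rewrite /mgf [leRHS](bigID (mem S)) /= lerDl sumr_ge0 // => x _.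
by rewrite mulr_ge0 ?expR_ge0 // ltW ?prodD_gt0.
Qed.

Lemma anti_coord (i : 'I_d) (b : bool) :
  lambda <= \sum_(x : cube d | x i == b) q x.
Proof.
pose w : 'rV[R]_d := delta_mx 0 i.
have dw x : dotc w x = (x i)%:R.
  rewrite /dotc (bigD1 i) //= !mxE !eqxx mul1r big1 ?addr0 // => j ji.
  by rewrite mxE (negbTE ji) andbF mul0r.
have nw : l2norm w = 1.
  rewrite /l2norm (bigD1 i) //= !mxE !eqxx expr1n big1 ?addr0 ?sqrtr1 // => j ji.
  by rewrite mxE (negbTE ji) andbF expr0n.
(* The direction is a basis vector and the centre is the opposite bit, so the points with [x i != b]
   lie inside the excluded interval. *)
apply: le_trans (anti (~~ b)%:R nw) _; rewrite /mass.
rewrite [leLHS]big_mkcond [leRHS]big_mkcond; apply: ler_sum => x _.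
rewrite inE dw -/q; have := trunc_ge0 x.
by case: (x i); case: b => //=; case: ifP => //; rewrite ltrBlDr ltrDl lambda0.
Qed.

Lemma tmean_bounds (i : 'I_d) : lambda <= tmean 0 i <= 1 - lambda.
Proof.
have e : tmean 0 i = \sum_(x : cube d | x i == true) q x.
  rewrite mxE [RHS]big_mkcond; apply: eq_bigr => x _.
  by case: (x i); rewrite ?mulr1 ?mulr0.
rewrite e anti_coord /= lerBrDr.
apply: le_trans (lerD (lexx _) (anti_coord i false)) _.
rewrite -trunc_sum1 [leRHS](bigID (fun x : cube d => x i == true)) /=.
by rewrite lerD2l; under [leRHS]eq_bigl do rewrite eqb_id -eqbF_neg.
Qed.

(** Apply [mgf_jensen] at [w], the logits of the mean minus [zs]. The ratio of its two sides factors
    over coordinates into moment generating functions of centred Bernoulli variables, each at least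
    [expR (lambda / 16 * hub (w 0 i))]. *)
Lemma Hub_logit_tmean :
  Hub ((\row_i logit (tmean 0 i)) - zs) <= 16 / lambda * ln alpha^-1.
Proof.
set zt := \row_i _; set w := zt - zs.
have h := mgf_jensen w.
have {h} : alpha * expR (lambda / 16 * Hub w) <= 1.
  have m0 := mgf_gt0 zs w.
  rewrite -(ler_pM2r m0) mul1r; apply: (le_trans _ h); rewrite -[leLHS]mulrA ler_pM2l //.
  rewrite -ler_pdivlMr //.
  rewrite mgfE -prodfV /dotr expR_sum -big_split /Hub mulr_sumr expR_sum /=.
  apply: ler_prod => i _; rewrite expR_ge0 /=.
  apply: logit_bern_mgf lambda0 (tmean_bounds i) _.
  by rewrite /w [LHS]mxE [(- zs) 0 i]mxE [zt 0 i]mxE.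
have l := expR_gt0 (lambda / 16 * Hub w).
rewrite mulrC -ler_pdivlMr // div1r => h.
have : lambda / 16 * Hub w <= ln alpha^-1.
  by rewrite -[leLHS]expRK ler_ln ?posrE ?invr_gt0.
have -> : 16 / lambda * ln alpha^-1 = ln alpha^-1 / (lambda / 16).
  by field; rewrite gt_eqF.
by rewrite ler_pdivlMr ?divr_gt0 // mulrC.
Qed.

Lemma gradient_strong w :
  lambda ^+ 4 * alpha ^+ 2 / ((1 + alpha^-1) * expR (3 * Hub w)) * sqn w
  <= \sum_(x in S) prodD (zs + w) x * (dotc w x - dotr w tmean).
Proof.
set m := dotr w tmean.
have [w0|/eqP nw] := eqVneq w 0.
  have c0 x : dotc w x = 0 by rewrite w0 /dotc big1 // => i _; rewrite mxE mul0r.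
  have m0 : m = 0 by rewrite /m w0 /dotr big1 // => i _; rewrite mxE mul0r.
  have s0 : sqn w = 0 by rewrite w0 /sqn big1 // => i _; rewrite mxE expr0n.
  by rewrite s0 mulr0 big1 // => x _; rewrite c0 m0 subrr mulr0.
pose n := l2norm w.
have n2 : n ^+ 2 = sqn w by rewrite sqr_sqrtr // sqn_ge0.
have n0 : 0 < n.
  rewrite lt_neqAle sqrtr_ge0 andbT; apply/eqP => e; apply: nw.
  by apply: sqn_eq0; rewrite -n2 -e expr0n.
have mw := mgf_gt0 zs w; have mw' := mgf_gt0 zs (- w).
have M0 := mass_gt0.
(* The tilt by [w] produces [expR (dotc w x)]. Since [dotc w x - m] has mean zero under the
   truncation, [expR m] may be subtracted, which makes every summand nonnegative. *)
have -> : \sum_(x in S) prodD (zs + w) x * (dotc w x - m) =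
  (\sum_(x in S) prodD zs x * ((expR (dotc w x) - expR m) * (dotc w x - m))) / mgf zs w.
  have z0 : \sum_(x in S) prodD zs x * (dotc w x - m) = 0.
    have := sum_trunc (fun x => dotc w x - m).
    under [LHS]eq_bigr do rewrite mulrBr.
    rewrite sumrB dotr_tmean -mulr_suml trunc_sum1 mul1r subrr.
    by move=> /(congr1 (fun t => t * mass (prodD zs) S)); rewrite mul0r divfK ?gt_eqF.
  transitivity ((\sum_(x in S) prodD zs x * (expR (dotc w x) * (dotc w x - m))) / mgf zs w).
    by rewrite mulr_suml; apply: eq_bigr => x _; rewrite prodD_tilt; ring.
  congr (_ / _); transitivity (\sum_(x in S) prodD zs x * (expR (dotc w x) * (dotc w x - m)) -
      expR m * \sum_(x in S) prodD zs x * (dotc w x - m)).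
    by rewrite z0 mulr0 subr0.
  by rewrite mulr_sumr -sumrB; apply: eq_bigr => x _; ring.
(* Anti-concentration for the unit vector [w / n], centred at [m / n]: on [E] the deviation from [m]
   is at least [lambda * n], and [E] meets [S] in mass at least [alpha * lambda]. *)
pose E : {set cube d} := [set x | ~~ (m / n - lambda < dotc (n^-1 *: w) x < m / n + lambda)].
have nE : l2norm (n^-1 *: w) = 1.
  by rewrite /l2norm -/(sqn _) sqnZ -n2 -exprMn mulVf ?gt_eqF // expr1n sqrtr1.
have hE x : x \in E -> (lambda * n) ^+ 2 <= (dotc w x - m) ^+ 2.
  rewrite inE dotcZ => /negP hx; rewrite leNgt; apply/negP => lt; apply: hx.
  have {lt}: `|dotc w x - m| < lambda * n.
    have ln0 : 0 <= lambda * n by apply: mulr_ge0; apply: ltW.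
    by rewrite -(@ltr_pXn2r _ 2) ?nnegrE // real_normK ?num_real.
  rewrite ltr_norml => /andP[h1 h2].
  have e : n^-1 * dotc w x = (dotc w x - m) / n + m / n.
    by rewrite -mulrDl subrK mulrC.
  have n1 : 0 < n^-1 by rewrite invr_gt0.
  have h1' : - lambda < (dotc w x - m) / n by rewrite ltr_pdivlMr // mulNr.
  have h2' : (dotc w x - m) / n < lambda by rewrite ltr_pdivrMr.
  by rewrite e; apply/andP; split; lra.
have massE : alpha * lambda <= \sum_(x | (x \in S) && (x \in E)) prodD zs x.
  have := anti (m / n) nE; rewrite -/E /mass.
  have -> : \sum_(x in E) prodD_trunc zs S x =
     (\sum_(x | (x \in S) && (x \in E)) prodD zs x) / mass (prodD zs) S.
    rewrite mulr_suml [LHS]big_mkcond [RHS]big_mkcond; apply: eq_bigr => x _.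
    by rewrite /prodD_trunc; case: (x \in S); case: (x \in E).
  rewrite ler_pdivlMr //; apply: le_trans.
  by rewrite mulrC ler_pM2l.
pose g x := expR (- dotc w x) + expR (- m).
have g0 x : 0 < g x by rewrite addr_gt0 ?expR_gt0.
(* [A] bounds the mean of [g]: one term gives [mgf zs (- w)], the other is [expR (- m)], at most
   [mgf zs (- w) / alpha] by Jensen's inequality at [- w]. *)
pose A := mgf zs (- w) * (1 + alpha^-1).
have A0 : 0 < A by rewrite mulr_gt0 // addr_gt0 // invr_gt0.
have hA : \sum_(x | (x \in S) && (x \in E)) prodD zs x * g x <= A.
  apply: (@le_trans _ _ (\sum_(x : cube d) prodD zs x * g x)).
    rewrite [leLHS]big_mkcond; apply: ler_sum => x _; case: ifP => // _.
    by rewrite mulr_ge0 ?ltW ?prodD_gt0.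
  under eq_bigr do rewrite /g mulrDr -dotcN.
  rewrite big_split /= -/(mgf zs (- w)) -mulr_suml prodD_sum1 mul1r /A mulrDr mulr1 lerD2l.
  rewrite ler_pdivlMr // mulrC; have := mgf_jensen (- w).
  by congr (_ * expR _ <= _); rewrite /m /dotr -sumrN; apply: eq_bigr => i _; rewrite mxE mulNr.
(* Turns the upper bound on the mean of [g] into a lower bound on the sum of [prodD zs x / g x] over
   the event. *)
have CS := sqr_sum_le (fun x => prodD zs x) A0 (fun x _ => mulr_gt0 (prodD_gt0 zs x) (g0 x)) hA.
have al : 0 <= alpha * lambda by apply: mulr_ge0; apply: ltW.
have B : (lambda * n) ^+ 2 * (\sum_(x | (x \in S) && (x \in E)) prodD zs x ^+ 2 / (prodD zs x * g x))
   <= \sum_(x in S) prodD zs x * ((expR (dotc w x) - expR m) * (dotc w x - m)).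
  rewrite [leRHS](bigID (mem E)) /= -[leLHS]addr0 lerD //; last first.
    apply: sumr_ge0 => x _; apply: mulr_ge0; first by rewrite ltW ?prodD_gt0.
    apply: le_trans (expR_monotone_quad _ _).
    by apply: divr_ge0; [exact: sqr_ge0|exact: ltW (g0 x)].
  rewrite mulr_sumr; apply: ler_sum => x /andP[_ xE].
  have px := prodD_gt0 zs x; have gx := g0 x.
  have -> : (lambda * n) ^+ 2 * (prodD zs x ^+ 2 / (prodD zs x * g x)) =
     prodD zs x * ((lambda * n) ^+ 2 / g x) by field; rewrite !gt_eqF.
  rewrite ler_pM2l //; apply: le_trans (expR_monotone_quad _ _).
  by rewrite ler_pM2r ?invr_gt0 // hE.
rewrite ler_pdivlMr //; apply: le_trans B.
set Q := \sum_(x | _) _ ^+ 2 / _ in CS *.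
have hQ : (alpha * lambda) ^+ 2 / A <= Q.
  rewrite ler_pdivrMr // [Q * A]mulrC; apply: (le_trans _ CS).
  by rewrite lerXn2r ?nnegrE // (le_trans al).
have a1 : 0 < 1 + alpha^-1 by rewrite addr_gt0 // invr_gt0.
apply: (@le_trans _ _ ((lambda * n) ^+ 2 * ((alpha * lambda) ^+ 2 / A))); last first.
  by rewrite ler_wpM2l ?sqr_ge0.
(* The factor [mgf zs w] from the tilt and [mgf zs (- w)] from [A] are bounded together; only their
   product is small. *)
have := mgf_mgfN zs w; set h := expR _ => hm.
have h0 : 0 < h := expR_gt0 _.
rewrite /A; move: (1 + alpha^-1) a1 => b b0.
have -> : lambda ^+ 4 * alpha ^+ 2 / (b * h) * sqn w * mgf zs w
  = lambda ^+ 4 * alpha ^+ 2 * n ^+ 2 / b * (mgf zs w / h).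
  by rewrite -n2; field; rewrite !gt_eqF.
have -> : (lambda * n) ^+ 2 * ((alpha * lambda) ^+ 2 / (mgf zs (- w) * b)) =
   lambda ^+ 4 * alpha ^+ 2 * n ^+ 2 / b * (mgf zs (- w))^-1.
  by field; rewrite !gt_eqF.
apply: ler_wpM2l; last by rewrite ler_pdivrMr // [_^-1 * h]mulrC ler_pdivlMr.
apply: divr_ge0; last exact: ltW.
by apply: mulr_ge0; [apply: mulr_ge0; apply: exprn_ge0; exact: ltW|exact: sqr_ge0].
Qed.

End Truncated.

(** * The estimator as a functional, and its analysis *)

Lemma sum_affine (R : comPzRingType) (I : finType) (p f : I -> R) (c0 c1 : R) :
  \sum_i p i = 1 -> \sum_i p i * (c0 + c1 * f i) = c0 + c1 * \sum_i p i * f i.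
Proof.
move=> p1; rewrite mulr_sumr -[c0 in RHS]mul1r -p1 mulr_suml -big_split.
by apply: eq_bigr => i _; rewrite mulrDr mulrCA.
Qed.

Section Algorithm.
Context {R : realType} {d : nat}.
Implicit Types (z w v a : 'rV[R]_d) (x y : cube d) (phi : 'rV[R]_d -> R).
Variables (S : {set cube d}) (q : cube d -> R).
Hypotheses (q0 : forall x, 0 <= q x) (q1 : \sum_(x : cube d) q x = 1).

(** The expectation of [phi] at [v] plus [n] independent samples. Phases are written with a
    continuation [phi], to match the backward rules for program runs. *)
Fixpoint mean_phase (n : nat) phi v : R :=
  if n is n'.+1 then \sum_(y : cube d) q y * mean_phase n' phi (v + bits y) else phi v.

(* A gradient step of length 1/4 for [Hub (z - a)]. *)
Definition pull a z : 'rV[R]_d :=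
  \row_i (z 0 i - (z 0 i - a 0 i) / jap (z 0 i - a 0 i) / 4).

Definition sgd_step (eta : R) z y x : 'rV[R]_d :=
  \row_i (z 0 i - eta * (x \in S)%:R * ((x i)%:R - (y i)%:R)).

Definition sgd_update (radius s j0 : R) a (j : nat) z y x : 'rV[R]_d :=
  if 2 * radius < Hub (z - a) then pull a z else sgd_step (s / (j%:R + j0)) z y x.

(** [y] and [x] are drawn in every step, also when [pull] ignores them, so each step costs exactly
    one sample and one query. The index [j] sets the step size. *)
Fixpoint sgd_phase (radius s j0 : R) a (n j : nat) phi z : R :=
  if n is n'.+1 then
    \sum_(y : cube d) q y * \sum_(x : cube d) prodD z x *
       sgd_phase radius s j0 a n' j.+1 phi (sgd_update radius s j0 a j z y x)
  else phi z.

Definition clamp (lambda t : R) : R :=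
  if t < lambda then lambda else if 1 - lambda < t then 1 - lambda else t.

Definition warm_start (lambda : R) (m : nat) v : 'rV[R]_d :=
  \row_i logit (clamp lambda (v 0 i / m%:R)).

Definition algorithm (eps lambda radius s j0 : R) (m : nat) phi : R :=
  mean_phase m (fun v => let a := warm_start lambda m v in
    if eps < 2 * radius then sgd_phase radius s j0 a m 0 phi a else phi a) 0.

Lemma mean_phase_le n phi psi v : (forall v, phi v <= psi v) ->
  mean_phase n phi v <= mean_phase n psi v.
Proof.
move=> h; elim: n v => [|n IH] v //=; apply: ler_sum => y _.
by rewrite ler_wpM2l.
Qed.

Lemma mean_phase_cst n (c : R) v : mean_phase n (fun=> c) v = c.
Proof.
elim: n v => [|n IH] v //=; under eq_bigr do rewrite IH.
by rewrite -mulr_suml q1 mul1r.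
Qed.

Lemma sgd_phase_cst radius s j0 a n j (c : R) z :
  sgd_phase radius s j0 a n j (fun=> c) z = c.
Proof.
elim: n j z => [|n IH] j z //=.
under eq_bigr => y _.
  under eq_bigr do rewrite IH.
  rewrite -mulr_suml prodD_sum1 mul1r; over.
by rewrite -mulr_suml q1 mul1r.
Qed.

Lemma sgd_phase_le radius s j0 a n j phi psi z : (forall z, phi z <= psi z) ->
  sgd_phase radius s j0 a n j phi z <= sgd_phase radius s j0 a n j psi z.
Proof.
move=> h; elim: n j z => [|n IH] j z //=; apply: ler_sum => y _.
apply: ler_wpM2l => //; apply: ler_sum => x _.
by apply: ler_wpM2l => //; rewrite ltW ?prodD_gt0.
Qed.

Lemma algorithm_cst eps lambda radius s j0 m (c : R) :
  algorithm eps lambda radius s j0 m (fun=> c) = c.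
Proof.
rewrite /algorithm -[RHS](mean_phase_cst m c 0).
by congr mean_phase; apply/funext => v; rewrite sgd_phase_cst; case: ifP.
Qed.

End Algorithm.

(** * Potential arguments for the two phases *)

Section Analysis.
Context {R : realType} {d : nat}.
Implicit Types (z w v a : 'rV[R]_d) (x y : cube d).
Variables (S : {set cube d}) (zs : 'rV[R]_d) (alpha lambda : R).
Hypotheses (alpha0 : 0 < alpha) (lambda0 : 0 < lambda).
Hypothesis massS : alpha <= mass (prodD zs) S.
Hypothesis anti : anti_concentrated (prodD_trunc zs S) lambda.

Let q := prodD_trunc zs S.
Let mu := tmean S zs.
Let q0 : forall x, 0 <= q x := trunc_ge0 alpha0 massS.
Let q1 : \sum_(x : cube d) q x = 1 := trunc_sum1 alpha0 massS.

Lemma dotrBr w v v' : dotr w (v - v') = dotr w v - dotr w v'.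
Proof. by rewrite /dotr -sumrB; apply: eq_bigr => i _; rewrite !mxE mulrBr. Qed.

Lemma mean_dotr w : \sum_(y : cube d) q y * dotr w (bits y) = dotr w mu.
Proof. by rewrite -dotr_tmean; apply: eq_bigr => x _; rewrite dotcE. Qed.

Lemma sqn_unit w : (forall i, -1 <= w 0 i <= 1) -> sqn w <= d%:R.
Proof.
move=> h; rewrite -[d in d%:R]card_ord -sumr_const; apply: ler_sum => i _.
by have /andP[] := h i; nra.
Qed.

Lemma unit_diff (t u : R) : 0 <= t <= 1 -> 0 <= u <= 1 -> -1 <= t - u <= 1.
Proof. by lra. Qed.

Lemma bits01 x i : 0 <= (bits x : 'rV[R]_d) 0 i <= 1.
Proof. by rewrite mxE; case: (x i); rewrite ?lexx ?ler01. Qed.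

(** The centred partial sums form a martingale whose increments have squared norm at most [d]. The
    test function [c - b * sqn] serves as a lower bound for a success probability, as in Markov's
    inequality. *)
Lemma mean_phase_potential n j v (b c : R) : 0 <= b ->
  c - b * (sqn (v - j%:R *: mu) + n%:R * d%:R) <=
  mean_phase q n (fun v' => c - b * sqn (v' - (j + n)%:R *: mu)) v.
Proof.
move=> b0; elim: n j v => [|n IH] j v /=; first by rewrite mul0r addr0 addn0.
apply: (@le_trans _ _ (\sum_(y : cube d) q y *
   (c - b * (sqn (v + bits y - j.+1%:R *: mu) + n%:R * d%:R)))); last first.
  by apply: ler_sum => y _; apply: ler_wpM2l => //; rewrite addnS -addSn; apply: IH.
set w := v - j%:R *: mu.
have e y : v + bits y - j.+1%:R *: mu = w + (bits y - mu).
  by apply/rowP => i; rewrite !mxE -natr1; ring.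
have h y : sqn (bits y - mu) <= d%:R.
  apply: sqn_unit => i; rewrite [(bits y - mu) 0 i]mxE [(- mu) 0 i]mxE.
  apply: (@unit_diff (bits y 0 i) (mu 0 i) (bits01 y i)).
  have /andP[h1 h2] := tmean_bounds alpha0 lambda0 massS anti i.
  apply/andP; split; first exact: le_trans (ltW lambda0) h1.
  by apply: le_trans h2 _; rewrite gerBl ltW.
apply: (@le_trans _ _ (\sum_(y : cube d) q y *
   (c - b * (sqn w + 2 * (dotr w (bits y) - dotr w mu) + d%:R + n%:R * d%:R)))); last first.
  apply: ler_sum => y _; apply: ler_wpM2l => //; rewrite lerD2l lerN2 ler_wpM2l //.
  by rewrite e sqnDe dotrBr lerD2r lerD2l.
rewrite le_eqVlt; apply/orP; left; apply/eqP.
transitivity (\sum_(y : cube d) q y *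
   (c - b * (sqn w - 2 * dotr w mu + d%:R + n%:R * d%:R) + (- b * 2) * dotr w (bits y))).
  by rewrite sum_affine // mean_dotr -natr1; ring.
by apply: eq_bigr => y _; congr (_ * _); ring.
Qed.

(** * Stochastic gradient descent with pull-back steps *)

Section SGD.
Variables (radius s j0 : R) (a : 'rV[R]_d).
Hypotheses (radius1 : 1 <= radius) (s0 : 0 < s) (j0_radius : 784 * radius <= j0).
Hypothesis j0_s : s ^+ 2 * d%:R <= j0 ^+ 2.
Hypothesis a_near : Hub (a - zs) <= radius.
Hypothesis curvature :
  s^-1 <= lambda ^+ 4 * alpha ^+ 2 / ((1 + alpha^-1) * expR (18 * radius)).

(** The bound [6 * radius], times the 3 in the exponent of [gradient_strong], is the [18 * radius]
    of [curvature]. *)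
Lemma region_Hub z : Hub (z - a) <= 2 * radius -> Hub (z - zs) <= 6 * radius.
Proof.
move=> h; have -> : z - zs = (z - a) + (a - zs) by rewrite addrA subrK.
by have := HubD (z - a) (a - zs); have := a_near; lra.
Qed.

Lemma region_sqn z : Hub (z - a) <= 2 * radius -> sqn (z - zs) <= 48 * radius ^+ 2.
Proof.
move=> /region_Hub h; have := sqn_le_Hub (z - zs); have := Hub_ge0 (z - zs).
by have := radius1; nra.
Qed.

(** By convexity the gradient [g] satisfies [dotr (z - zs) g >= Hub (z - a) - radius], and
    [sqn g <= 2 * Hub (z - a)]. With step 1/4 the change is at most
    [radius / 2 - 3 / 8 * Hub (z - a)]. *)
Lemma sqn_pull z : 2 * radius < Hub (z - a) ->
  sqn (pull a z - zs) <= sqn (z - zs) - radius / 4.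
Proof.
move=> h; pose g : 'rV[R]_d := \row_i ((z - a) 0 i / jap ((z - a) 0 i)).
have -> : pull a z - zs = (z - zs) + (- 4^-1) *: g.
  by apply/rowP => i; rewrite !mxE; field; rewrite gt_eqF // (lt_le_trans _ (jap_ge1 _)).
have h1 : Hub (z - a) - Hub (zs - a) <= dotr (z - zs) g.
  rewrite /Hub -sumrB; apply: ler_sum => i _.
  rewrite [g 0 i]mxE mulrC; apply: le_trans (hub_tangent _ _) _.
  by rewrite le_eqVlt; apply/orP; left; apply/eqP; congr (_ * _); rewrite !mxE; ring.
have h2 : sqn g <= 2 * Hub (z - a).
  by rewrite mulr_sumr; apply: ler_sum => i _; rewrite [g 0 i]mxE hub_grad.
have h3 : Hub (zs - a) <= radius by rewrite -HubN opprB.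
rewrite sqnDe sqnZ.
have -> : dotr (z - zs) (- 4^-1 *: g) = - 4^-1 * dotr (z - zs) g.
  by rewrite /dotr mulr_sumr; apply: eq_bigr => i _; rewrite [(_ *: g) 0 i]mxE; ring.
by lra.
Qed.

Lemma sqn_sgd eta z y x : 0 <= eta ->
  sqn (sgd_step S eta z y x - zs) <= sqn (z - zs) + eta ^+ 2 * d%:R
   - 2 * eta * ((x \in S)%:R * (dotc (z - zs) x - dotr (z - zs) (bits y))).
Proof.
move=> eta0; set b : R := (x \in S)%:R.
have -> : sgd_step S eta z y x - zs = (z - zs) + (- (eta * b)) *: (bits x - bits y).
  by apply/rowP => i; rewrite !mxE -/b; ring.
rewrite sqnDe sqnZ.
have -> : dotr (z - zs) (- (eta * b) *: (bits x - bits y)) =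
   - (eta * b) * (dotc (z - zs) x - dotr (z - zs) (bits y)).
  rewrite dotcE -dotrBr /dotr mulr_sumr; apply: eq_bigr => i _.
  by rewrite [(_ *: (bits x - bits y)) 0 i]mxE; ring.
have h : sqn (bits x - bits y) <= d%:R :> R.
  apply: sqn_unit => i; rewrite !mxE.
  by case: (x i); case: (y i); rewrite /=; lra.
have hb : b ^+ 2 <= 1 by rewrite /b; case: (x \in S); rewrite ?expr1n ?expr0n.
have sq0 := sqn_ge0 (bits x - bits y : 'rV[R]_d).
have : (- (eta * b)) ^+ 2 * sqn (bits x - bits y : 'rV[R]_d) <= eta ^+ 2 * d%:R.
  rewrite sqrrN exprMn -mulrA ler_wpM2l ?sqr_ge0 //.
  apply: (le_trans _ h); rewrite -[leRHS]mul1r ler_wpM2r //.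
by nra.
Qed.

(** Holds for every outcome, not only on average. A pull decreases the distance; a stochastic step
    is taken only where [sqn (z - zs) <= 48 * radius ^+ 2] and moves by at most 1 in squared norm,
    and [2 * 48 + 2 = 98]. *)
Lemma sgd_update_invariant j z y x : sqn (z - zs) <= 98 * radius ^+ 2 ->
  sqn (sgd_update S radius s j0 a j z y x - zs) <= 98 * radius ^+ 2.
Proof.
move=> h; rewrite /sgd_update; case: ltP => hz.
  by apply: le_trans (sqn_pull hz) _; have := radius1; lra.
set t := j%:R + j0.
have t0 : j0 <= t by rewrite lerDr.
have j00 : 0 < j0 by have := radius1; have := j0_radius; lra.
have tp : 0 < t by apply: lt_le_trans t0.
pose b : R := (x \in S)%:R.
have -> : sgd_step S (s / t) z y x - zs = (z - zs) + (- (s / t * b)) *: (bits x - bits y).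
  by apply/rowP => i; rewrite !mxE -/b; ring.
apply: le_trans (sqnD _ _) _; rewrite sqnZ.
have h1 := region_sqn hz.
have h2 : sqn (bits x - bits y) <= d%:R :> R.
  apply: sqn_unit => i; rewrite !mxE.
  by case: (x i); case: (y i); rewrite /=; lra.
have hb : b ^+ 2 <= 1 by rewrite /b; case: (x \in S); rewrite ?expr1n ?expr0n.
have h3 : (- (s / t * b)) ^+ 2 * sqn (bits x - bits y : 'rV[R]_d) <= 1.
  rewrite sqrrN exprMn mulrAC -[leRHS]mul1r; apply: ler_pM => //; last first.
  - apply: (@le_trans _ _ ((s / t) ^+ 2 * d%:R)); first by rewrite ler_wpM2l ?sqr_ge0.
    rewrite expr_div_n mulrAC ler_pdivrMr ?exprn_gt0 // mul1r.
    by apply: le_trans j0_s _; rewrite lerXn2r ?nnegrE // ltW.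
  - exact: sqr_ge0.
  - by apply: mulr_ge0; [exact: sqr_ge0|exact: sqn_ge0].
by have := radius1; nra.
Qed.

(** Both kinds of step meet the same recursion: the pull by its fixed decrease, the stochastic step
    by strong monotonicity with step size [s / t]. *)
Lemma sgd_update_contracts j z : sqn (z - zs) <= 98 * radius ^+ 2 ->
  \sum_(y : cube d) q y * \sum_(x : cube d) prodD z x *
     sqn (sgd_update S radius s j0 a j z y x - zs) <=
  (1 - 2 / (j%:R + j0)) * sqn (z - zs) + s ^+ 2 * d%:R / (j%:R + j0) ^+ 2.
Proof.
move=> h; rewrite /sgd_update; set t := j%:R + j0.
have t0 : j0 <= t by rewrite lerDr.
have j00 : 0 < j0 by have := radius1; have := j0_radius; lra.
have tp : 0 < t by apply: lt_le_trans t0.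
case: ltP => hz.
  under eq_bigr do rewrite -mulr_suml prodD_sum1 mul1r.
  rewrite -mulr_suml q1 mul1r; apply: le_trans (sqn_pull hz) _.
  have c : 0 <= s ^+ 2 * d%:R / t ^+ 2.
    by apply: divr_ge0; [apply: mulr_ge0; rewrite ?sqr_ge0|exact: sqr_ge0].
  (* The origin of 784: [2 * 98 * radius ^+ 2 / (784 * radius)] equals [radius / 4]. *)
  have : 2 / t * sqn (z - zs) <= radius / 4.
    rewrite mulrAC ler_pdivrMr //; have := radius1; have := j0_radius; nra.
  by lra.
set w := z - zs; have ez : z = zs + w by rewrite /w addrC subrK.
set eta := s / t; have eta0 : 0 <= eta by rewrite divr_ge0 ?ltW.
apply: (@le_trans _ _ (\sum_(y : cube d) q y * \sum_(x : cube d) prodD z x *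
   (sqn w + eta ^+ 2 * d%:R - 2 * eta * ((x \in S)%:R * (dotc w x - dotr w (bits y)))))).
  apply: ler_sum => y _; apply: ler_wpM2l => //; apply: ler_sum => x _.
  by apply: ler_wpM2l; [rewrite ltW ?prodD_gt0|exact: sqn_sgd].
pose G := \sum_(x in S) prodD z x * (dotc w x - dotr w mu).
have -> : \sum_(y : cube d) q y * \sum_(x : cube d) prodD z x *
   (sqn w + eta ^+ 2 * d%:R - 2 * eta * ((x \in S)%:R * (dotc w x - dotr w (bits y))))
   = sqn w + eta ^+ 2 * d%:R - 2 * eta * G.
  pose M := \sum_(x in S) prodD z x; pose Q := \sum_(x in S) prodD z x * dotc w x.
  have inner y : \sum_(x : cube d) prodD z x *
     (sqn w + eta ^+ 2 * d%:R - 2 * eta * ((x \in S)%:R * (dotc w x - dotr w (bits y))))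
     = sqn w + eta ^+ 2 * d%:R - 2 * eta * (Q - M * dotr w (bits y)).
    under eq_bigr do rewrite mulrBr [prodD _ _ * (2 * _ * _)]mulrCA.
    rewrite sumrB -mulr_suml prodD_sum1 mul1r -mulr_sumr; congr (_ - _ * _).
    rewrite /Q /M mulr_suml -sumrB [RHS]big_mkcond; apply: eq_bigr => x _.
    by case: (x \in S); rewrite ?mul1r ?mul0r ?mulr0 ?mulrBr.
  have -> : G = Q - M * dotr w mu.
    by rewrite /G /Q /M mulr_suml -sumrB; apply: eq_bigr => x _; rewrite mulrBr.
  transitivity (\sum_(y : cube d) q y *
     ((sqn w + eta ^+ 2 * d%:R - 2 * eta * Q) + 2 * eta * M * dotr w (bits y))).
    by apply: eq_bigr => y _; rewrite inner; congr (_ * _); ring.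
  by rewrite sum_affine // mean_dotr; ring.
have hG : s^-1 * sqn w <= G.
  have := gradient_strong alpha0 lambda0 massS anti w; rewrite -ez -/mu -/G.
  apply: le_trans; apply: ler_wpM2r; first exact: sqn_ge0.
  apply: le_trans curvature _; apply: ler_wpM2l.
    by apply: mulr_ge0; apply: exprn_ge0; apply: ltW.
  have a1 : 0 < 1 + alpha^-1 by rewrite addr_gt0 // invr_gt0.
  rewrite lef_pV2 ?posrE ?mulr_gt0 ?expR_gt0 // ler_pM2l // ler_expR.
  by have := region_Hub hz; rewrite -/w; lra.
have -> : s ^+ 2 * d%:R / t ^+ 2 = eta ^+ 2 * d%:R by rewrite /eta; field; rewrite gt_eqF.
have : eta * (s^-1 * sqn w) <= eta * G by rewrite ler_wpM2l.
have -> : eta * (s^-1 * sqn w) = sqn w / t by rewrite /eta; field; rewrite !gt_eqF.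
lra.
Qed.

(** The potential is [t ^+ 2 * sqn (z - zs)] with [t = j + j0]:
    [(t + 1) ^+ 2 * (1 - 2 / t) <= t ^+ 2] absorbs the contraction, and [(t + 1) ^+ 2 <= 4 * t ^+ 2]
    bounds the added noise. *)
Lemma sgd_phase_potential n j z (b c : R) : 0 <= b -> sqn (z - zs) <= 98 * radius ^+ 2 ->
  c - b * ((j%:R + j0) ^+ 2 * sqn (z - zs) + n%:R * (4 * s ^+ 2 * d%:R)) <=
  sgd_phase S q radius s j0 a n j
    (fun z' => c - b * ((j + n)%:R + j0) ^+ 2 * sqn (z' - zs)) z.
Proof.
move=> b0; elim: n j z => [|n IH] j z hz /=.
  by rewrite mul0r addr0 addn0 mulrA.
set c' := n%:R * (4 * s ^+ 2 * d%:R).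
set t := j%:R + j0.
apply: (@le_trans _ _ (\sum_(y : cube d) q y * \sum_(x : cube d) prodD z x *
   (c - b * ((t + 1) ^+ 2 * sqn (sgd_update S radius s j0 a j z y x - zs) + c')))); last first.
  apply: ler_sum => y _; apply: ler_wpM2l => //; apply: ler_sum => x _.
  apply: ler_wpM2l; first by rewrite ltW ?prodD_gt0.
  have := IH j.+1 _ (sgd_update_invariant j y x hz).
  by rewrite addnS addSn -natr1 [j%:R + 1 + j0]addrAC.
have -> : \sum_(y : cube d) q y * \sum_(x : cube d) prodD z x *
   (c - b * ((t + 1) ^+ 2 * sqn (sgd_update S radius s j0 a j z y x - zs) + c')) =
   c - b * c' - b * (t + 1) ^+ 2 * (\sum_(y : cube d) q y * \sum_(x : cube d) prodD z x *
     sqn (sgd_update S radius s j0 a j z y x - zs)).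
  have h0 : c - b * c' - b * (t + 1) ^+ 2 * (\sum_(y : cube d) q y * \sum_(x : cube d) prodD z x *
     sqn (sgd_update S radius s j0 a j z y x - zs)) = (c - b * c') + (- (b * (t + 1) ^+ 2)) * (\sum_(y : cube d) q y * \sum_(x : cube d) prodD z x *
     sqn (sgd_update S radius s j0 a j z y x - zs)) by ring.
  rewrite h0 -(sum_affine _ _ _ q1); apply: eq_bigr => y _; congr (_ * _).
  rewrite -(sum_affine _ _ _ (prodD_sum1 z)); apply: eq_bigr => x _; congr (_ * _); ring.
have := sgd_update_contracts j hz; rewrite -/t.
set E := \sum_(y : cube d) _; move: (sqn_ge0 (z - zs)); set e := sqn _ => e0 hE.
have t0 : 1 <= t.
  apply: (@le_trans _ _ j0); last by rewrite lerDr.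
  by have := radius1; have := j0_radius; lra.
have tp : 0 < t by lra.
have cc0 : 0 <= s ^+ 2 * d%:R by apply: mulr_ge0; rewrite ?sqr_ge0.
have : (t + 1) ^+ 2 * E <= t ^+ 2 * e + 4 * s ^+ 2 * d%:R.
  apply: (@le_trans _ _ ((t + 1) ^+ 2 * ((1 - 2 / t) * e + s ^+ 2 * d%:R / t ^+ 2))).
    by apply: ler_wpM2l => //; apply: sqr_ge0.
  rewrite mulrDr; apply: lerD.
    rewrite mulrA; apply: ler_wpM2r => //.
    have -> : (t + 1) ^+ 2 * (1 - 2 / t) = t ^+ 2 - 3 - 2 / t by field; rewrite gt_eqF.
    have : 0 < 2 / t by apply: divr_gt0.
    lra.
  rewrite mulrA ler_pdivrMr ?exprn_gt0 //.
  have : (t + 1) ^+ 2 <= 4 * t ^+ 2 by nra.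
  nra.
rewrite -natr1 /c'; nra.
Qed.

End SGD.

End Analysis.

(** * Clamped logits *)

Section WarmStart.
Context {R : realType}.

Lemma clamp_bounds (lambda t : R) : lambda <= 1 - lambda ->
  lambda <= clamp lambda t <= 1 - lambda.
Proof. by rewrite /clamp => h; case: ifP => h1; [|case: ifP => h2]; lra. Qed.

Lemma clamp_contracts (lambda t mu : R) : lambda <= mu <= 1 - lambda ->
  (clamp lambda t - mu) ^+ 2 <= (t - mu) ^+ 2.
Proof.
move=> /andP[m1 m2]; rewrite /clamp; case: ltP => h1; first by nra.
by case: ltP => h2 //; nra.
Qed.

Lemma logit_clamp_lip (lambda t mu : R) : 0 < lambda -> lambda <= mu <= 1 - lambda ->
  (logit (clamp lambda t) - logit mu) ^+ 2 <= 4 / lambda ^+ 2 * (t - mu) ^+ 2.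
Proof.
move=> l0 hm; have hc : lambda <= clamp lambda t <= 1 - lambda.
  by apply: clamp_bounds; lra.
have := logit_lip l0 hc hm; set x := logit _ - _ => h.
apply: (@le_trans _ _ (4 / lambda ^+ 2 * (clamp lambda t - mu) ^+ 2)); last first.
  by apply: ler_wpM2l; [apply: divr_ge0; rewrite ?sqr_ge0|exact: clamp_contracts].
rewrite -(real_normK (num_real x)) -(real_normK (num_real (clamp _ _ - _))).
have -> : 4 / lambda ^+ 2 = (2 / lambda) ^+ 2 by field; rewrite gt_eqF.
rewrite -exprMn lerXn2r ?nnegrE //.
by apply: mulr_ge0 => //; apply: divr_ge0 => //; apply: ltW.
Qed.

End WarmStart.

(** * Arithmetic of the step budget *)

Section StepBudget.
Context {R : realFieldType}.
Implicit Types M D J r s eps K sq h : R.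

Lemma start_time_ge D J s : 0 < s -> s <= J -> 1 <= D -> s ^+ 2 * D <= (J * D) ^+ 2.
Proof.
move=> s0 sJ D1; rewrite exprMn; apply: ler_pM => //; first exact: sqr_ge0.
- by lra.
- by rewrite lerXn2r ?nnegrE; lra.
- by nra.
Qed.

Lemma steps_ge D r eps K : 1 <= r -> 0 < eps -> eps < 2 * r -> 4 * r ^+ 2 <= K -> 1 <= D ->
  1 <= K * (D / eps ^+ 2).
Proof.
move=> r1 e0 er hK D1; have e2 : 0 < eps ^+ 2 by rewrite exprn_gt0.
rewrite mulrA ler_pdivlMr // mul1r.
have h1 : eps ^+ 2 <= 4 * r ^+ 2 by nra.
have h2 : 0 <= K by nra.
by nra.
Qed.

Lemma radius_ratio_le1 r eps : 1 <= r -> 0 < eps -> eps < 2 * r ->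
  eps ^+ 2 / (4 * r ^+ 2) <= 1.
Proof. by move=> r1 e0 er; rewrite ler_pdivrMr; nra. Qed.

Lemma Hub_budget r h : 0 <= h -> h <= r -> 1 <= r -> h ^+ 2 + 2 * h <= 3 * r ^+ 2.
Proof. by nra. Qed.

Lemma radius_budget r J K : 1 <= r -> 784 * r <= J -> 140 * r ^+ 2 * J <= K ->
  4 * r ^+ 2 <= K.
Proof.
move=> r1 Jr; apply: le_trans; have J1 : 1 <= J by lra.
by rewrite -mulrA; nra.
Qed.

Lemma one_sub_ge h : h <= 1 / 200 -> 199 / 200 <= 1 - h.
Proof. by lra. Qed.

Lemma ler_trunc_double (x M : R) : x < M + 1 -> 1 <= M -> x <= 2 * M.
Proof. by lra. Qed.

(** [M] is the number of steps and [J * D] the initial time. The noise takes 1/400 of the target and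
    the initial potential 3/1225; together they stay below 1/200. *)
Lemma step_budget M D J r s eps K sq :
  1 <= r -> 0 < eps -> eps < 2 * r -> 0 <= D -> 0 <= J -> 3200 * s ^+ 2 <= K ->
  140 * r ^+ 2 * J <= K -> 0 < M -> K * D <= 2 * (M * eps ^+ 2) -> sq <= 3 * r ^+ 2 ->
  (J * D) ^+ 2 * sq + M * (4 * s ^+ 2 * D) <= 1 / 200 * ((M + J * D) ^+ 2 * eps ^+ 2).
Proof.
move=> r1 e0 er D0 J0 Ks KJ M0 hM hsq.
have JD : 0 <= J * D by apply: mulr_ge0.
pose X := r * (J * D).
have h1 : 1600 * (s ^+ 2 * D) <= M * eps ^+ 2.
  have := ler_wpM2r D0 Ks; clear - hM; lra.
have h2 : 35 * X <= M * eps.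
  have r0 : 0 < 2 * r by clear - r1; lra.
  (* With [eps < 2 * r], one factor [eps] is traded for [2 * r], leaving [35 * X <= M * eps]. *)
  have h : 70 * r ^+ 2 * (J * D) <= M * eps ^+ 2.
    have := ler_wpM2r D0 KJ; clear - hM; lra.
  have h' : M * eps ^+ 2 <= M * eps * (2 * r).
    by rewrite expr2 mulrA ler_wpM2l ?ltW // mulr_gt0.
  rewrite -(ler_pM2r r0); apply: le_trans h'; apply: le_trans h.
  by rewrite /X le_eqVlt; apply/orP; left; apply/eqP; ring.
have X0 : 0 <= X by apply: mulr_ge0 => //; clear - r1; lra.
have h3 : (35 * X) ^+ 2 <= (M * eps) ^+ 2.
  rewrite lerXn2r ?nnegrE //; first by apply: mulr_ge0.
  by apply: mulr_ge0; apply: ltW.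
have h4 : (J * D) ^+ 2 * sq <= 3 * X ^+ 2.
  apply: (@le_trans _ _ ((J * D) ^+ 2 * (3 * r ^+ 2))).
    by apply: ler_wpM2l => //; apply: sqr_ge0.
  by rewrite /X le_eqVlt; apply/orP; left; apply/eqP; ring.
have h5 : (M * eps) ^+ 2 <= (M + J * D) ^+ 2 * eps ^+ 2.
  have M0' := ltW M0; rewrite exprMn; apply: ler_wpM2r; first exact: sqr_ge0.
  by rewrite lerXn2r ?nnegrE ?lerDl ?addr_ge0.
have h6 : M * (1600 * (s ^+ 2 * D)) <= (M * eps) ^+ 2.
  have -> : (M * eps) ^+ 2 = M * (M * eps ^+ 2) by ring.
  by apply: ler_wpM2l => //; apply: ltW.
have X2 : 0 <= X ^+ 2 by apply: sqr_ge0.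
have e3 : (35 * X) ^+ 2 = 1225 * X ^+ 2 by ring.
rewrite e3 in h3.
have h7 : M * (4 * s ^+ 2 * D) = M * (1600 * (s ^+ 2 * D)) / 400 by field.
rewrite h7.
move: h4 h6 h5 h3 X2.
move: ((J * D) ^+ 2 * sq) (M * (1600 * _)) ((M + _) ^+ 2 * _) ((M * eps) ^+ 2) (X ^+ 2).
by clear => a b c e x; lra.
Qed.

End StepBudget.

(** * Success probability of the estimator *)

Section Correctness.
Context {R : realType} {d : nat}.
Implicit Types (z w v a : 'rV[R]_d).
Variables (S : {set cube d}) (zs : 'rV[R]_d) (alpha lambda : R).
Hypotheses (alpha0 : 0 < alpha) (lambda0 : 0 < lambda).
Hypothesis massS : alpha <= mass (prodD zs) S.
Hypothesis anti : anti_concentrated (prodD_trunc zs S) lambda.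

Let q := prodD_trunc zs S.
Let mu := tmean S zs.
Let zt : 'rV[R]_d := \row_i logit (mu 0 i).
Let q0 : forall x, 0 <= q x := trunc_ge0 alpha0 massS.
Let q1 : \sum_(x : cube d) q x = 1 := trunc_sum1 alpha0 massS.

Variables (eps radius s J K : R).
Hypothesis eps0 : 0 < eps.
Hypothesis radius_ge : 32 / lambda * ln alpha^-1 + 1 <= radius.
Hypothesis s0 : 0 < s.
Hypothesis curvature :
  s^-1 <= lambda ^+ 4 * alpha ^+ 2 / ((1 + alpha^-1) * expR (18 * radius)).
Hypotheses (J_s : s <= J) (J_radius : 784 * radius <= J).
Hypotheses (K_radius : 6400 * radius ^+ 2 / lambda ^+ 2 <= K) (K_s : 3200 * s ^+ 2 <= K).
Hypothesis K_J : 140 * radius ^+ 2 * J <= K.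

Let m := Num.truncn (K * (d%:R / eps ^+ 2)).
Let good z : R := ((l2norm (zs - z) <= eps)%R)%:R.

Lemma sqn_warm_start v :
  sqn (warm_start lambda m v - zt) <= 4 / lambda ^+ 2 * sqn (m%:R^-1 *: v - mu).
Proof.
rewrite mulr_sumr; apply: ler_sum => i _.
have -> : (warm_start lambda m v - zt) 0 i = logit (clamp lambda (v 0 i / m%:R)) - logit (mu 0 i).
  by rewrite [LHS]mxE [(- zt) 0 i]mxE [zt 0 i]mxE [warm_start _ _ _ 0 i]mxE.
have -> : (m%:R^-1 *: v - mu) 0 i = v 0 i / m%:R - mu 0 i.
  by rewrite [LHS]mxE [(- mu) 0 i]mxE [(_ *: v) 0 i]mxE mulrC.
exact: logit_clamp_lip lambda0 (tmean_bounds alpha0 lambda0 massS anti i).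
Qed.

(** The pointwise form of Markov's inequality. *)
Lemma good_ge z : 1 - sqn (z - zs) / eps ^+ 2 <= good z.
Proof.
have e2 : 0 < eps ^+ 2 by rewrite exprn_gt0.
rewrite /good; case: (boolP (l2norm (zs - z) <= eps)) => /= h.
  by rewrite lerBlDr lerDl; apply: divr_ge0; [exact: sqn_ge0|exact: ltW].
rewrite subr_le0 ler_pdivlMr // mul1r leNgt; apply: contra h => h.
by apply: l2norm_le; [exact: ltW|rewrite -sqnN opprB ltW].
Qed.

Lemma good_ge0 z : 0 <= good z. Proof. by rewrite /good ler0n. Qed.

Lemma radius_ge1 : 1 <= radius.
Proof.
apply: le_trans radius_ge; rewrite lerDr; apply: mulr_ge0; first by apply: divr_ge0 => //; apply: ltW.
by apply: ln_ge0; rewrite invf_ge1 // (alpha_le1 massS).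
Qed.

(** The slack leaves room for the sampling error: [Hub (a - zt) <= 1 / 2] then gives
    [Hub (a - zs) <= 1 + (radius - 1)]. *)
Lemma Hub_zt : Hub (zt - zs) <= (radius - 1) / 2.
Proof.
apply: le_trans (Hub_logit_tmean alpha0 lambda0 massS anti) _.
move: radius_ge; have -> : 32 / lambda * ln alpha^-1 = 2 * (16 / lambda * ln alpha^-1) by ring.
lra.
Qed.

Lemma second_phase_good a : (0 < d)%N ->
  sqn (a - zt) <= 1600 / (lambda ^+ 2 * K) * eps ^+ 2 ->
  199 / 200 <= (if eps < 2 * radius then
    sgd_phase S q radius s (J * d%:R) a m 0 good a else good a).
Proof.
move=> d0 ha; have r1 := radius_ge1; have hz := Hub_zt.
have l2 : 0 < lambda ^+ 2 by rewrite exprn_gt0.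
have e2 : 0 < eps ^+ 2 by rewrite exprn_gt0.
have s2 : 0 < s ^+ 2 by rewrite exprn_gt0.
have K0 : 0 < K by have := K_s; nra.
have hz0 := Hub_ge0 (zt - zs).
have ha0 := sqn_ge0 (a - zt).
have lK : 6400 * radius ^+ 2 <= lambda ^+ 2 * K.
  by rewrite [leRHS]mulrC -ler_pdivrMr.
have {}ha : sqn (a - zt) <= eps ^+ 2 / (4 * radius ^+ 2).
  apply: le_trans ha _; rewrite mulrC ler_pM2l //.
  rewrite ler_pdivrMr ?mulr_gt0 // mulrC ler_pdivlMr; nra.
have esplit : a - zs = (a - zt) + (zt - zs) by rewrite addrA subrK.
(* For [eps >= 2 * radius] the starting point is already within [eps] of [zs]: sampling error and
   bias fit into [eps ^+ 2] together. *)
case: ltP => he; last first.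
  have h1 := sqnD (a - zt) (zt - zs); rewrite -esplit in h1.
  have h2 := sqn_le_Hub (zt - zs).
  have h3 : sqn (a - zt) <= eps ^+ 2 / 4.
    by apply: le_trans ha _; rewrite ler_pM2l // lef_pV2 ?posrE //; nra.
  have -> : good a = 1.
    rewrite /good l2norm_le //; first exact: ltW.
    by rewrite -sqnN opprB; apply: le_trans h1 _; nra.
  lra.
have Jr := J_radius; have Js := J_s; have sp := s0; have ep := eps0.
have Ks := K_s; have KJ := K_J.
pose D : R := d%:R; have D1 : 1 <= D by rewrite ler1n.
have J0 : 0 <= J by apply: le_trans Js; apply: ltW.
have D0 : 0 <= D by apply: le_trans D1.
have j0r : 784 * radius <= J * D by apply: le_trans Jr _; rewrite ler_peMr.
have j0s : s ^+ 2 * d%:R <= (J * D) ^+ 2 by apply: start_time_ge.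
have hat : sqn (a - zt) <= 1.
  by apply: le_trans ha _; apply: radius_ratio_le1.
have aH : Hub (a - zs) <= radius.
  rewrite esplit; apply: le_trans (HubD _ _) _.
  have := Hub_le_sqn (a - zt); lra.
have as3 : sqn (a - zs) <= 3 * radius ^+ 2.
  by apply: le_trans (sqn_le_Hub _) _; apply: Hub_budget; rewrite ?Hub_ge0.
pose M : R := m%:R.
have M0 : 0 <= M by rewrite ler0n.
have K4 : 4 * radius ^+ 2 <= K.
  exact: radius_budget r1 Jr KJ.
have big := steps_ge r1 ep he K4 D1.
have M1 : 1 <= M by rewrite ler1n truncn_gt0.
have hM : K * D <= 2 * (M * eps ^+ 2).
  have : K * (D / eps ^+ 2) < M + 1 by rewrite /M natr1; apply: truncnS_gt.
  by move=> /ler_trunc_double /(_ M1); rewrite mulrA ler_pdivrMr // [2 * (M * _)]mulrA.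
have Mp : 0 < M by apply: lt_le_trans M1.
(* Normalised so that the final potential times [b] is [sqn (z - zs) / eps ^+ 2], the quantity in
   [good_ge]. *)
pose b := ((M + J * D) ^+ 2 * eps ^+ 2)^-1.
have MJ : 0 < M + J * D by apply: ltr_wpDr => //; apply: mulr_ge0.
have b0 : 0 < b by rewrite invr_gt0 mulr_gt0 // exprn_gt0.
have a98 : sqn (a - zs) <= 98 * radius ^+ 2.
  by apply: le_trans as3 _; rewrite ler_wpM2r ?sqr_ge0 // ler_nat.
have P := sgd_phase_potential alpha0 lambda0 massS anti r1 s0 j0r j0s aH curvature m 0 1 (ltW b0) a98.
apply: (@le_trans _ _ _ _ _ _ (le_trans P _)); last first.
  apply: sgd_phase_le => // z; apply: le_trans (good_ge z).
  rewrite add0n -/M -/D.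
  have -> : b * (M + J * D) ^+ 2 * sqn (z - zs) = sqn (z - zs) / eps ^+ 2.
    by rewrite /b; field; rewrite !gt_eqF.
  by [].
rewrite -/D -/M add0r.
suff : b * ((J * D) ^+ 2 * sqn (a - zs) + M * (4 * s ^+ 2 * D)) <= 1 / 200.
  exact: one_sub_ge.
rewrite /b mulrC ler_pdivrMr ?mulr_gt0 ?exprn_gt0 //.
exact: (step_budget r1 ep he D0 J0 Ks KJ Mp hM as3).
Qed.

(** Each phase fails with probability at most 1/200: the first by Markov's inequality for the
    empirical mean, the second by [second_phase_good]. *)
Lemma algorithm_good : (0 < d)%N ->
  99 / 100 <= algorithm S q eps lambda radius s (J * d%:R) m good.
Proof.
move=> d0.
have r1 := radius_ge1; have e2 : 0 < eps ^+ 2 by rewrite exprn_gt0.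
have l2 : 0 < lambda ^+ 2 by rewrite exprn_gt0.
have s2 : 0 < s ^+ 2 by rewrite exprn_gt0.
have K0 : 0 < K by have := K_s; nra.
have D1 : 1 <= d%:R :> R by rewrite ler1n.
(* Without samples the empirical mean is read as 0. Its squared error is then at most [d], and
   [m = 0] means [K * d < eps ^+ 2], so this is accurate enough. *)
have [m0|m0] := posnP m.
  have small : K * d%:R < eps ^+ 2.
    have : K * (d%:R / eps ^+ 2) < 1.
      by rewrite ltNge -truncn_gt0 -/m m0.
    by rewrite mulrA ltr_pdivrMr // mul1r.
  suff ha : sqn (warm_start lambda m 0 - zt) <= 1600 / (lambda ^+ 2 * K) * eps ^+ 2.
    have := second_phase_good d0 ha; rewrite /algorithm m0 /= => h.
    by apply: le_trans h; lra.
  apply: le_trans (sqn_warm_start _) _; rewrite m0 scaler0 sub0r sqnN.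
  have h : sqn mu <= d%:R.
    apply: sqn_unit => i; have /andP[h1 h2] := tmean_bounds alpha0 lambda0 massS anti i.
    apply/andP; split; first by apply: le_trans h1; apply: le_trans (ltW lambda0); lra.
    by apply: le_trans h2 _; rewrite gerBl ltW.
  have -> : 1600 / (lambda ^+ 2 * K) * eps ^+ 2 = 4 / lambda ^+ 2 * (400 * (eps ^+ 2 / K)).
    by field; rewrite !gt_eqF.
  apply: ler_wpM2l; first by apply: divr_ge0 => //; apply: ltW.
  apply: (le_trans h); apply: (@le_trans _ _ (eps ^+ 2 / K)).
    by rewrite ler_pdivlMr // mulrC ltW.
  by rewrite ler_peMl ?ler1n //; apply: divr_ge0; apply: ltW.
pose M : R := m%:R; have M1 : 1 <= M by rewrite ler1n.
(* The tolerated squared error of the empirical mean. Beyond it the lower bound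
   [199 / 200 - b * sqn] is negative and there is nothing to prove. *)
pose tau := 400 * eps ^+ 2 / K.
have tau0 : 0 < tau by rewrite divr_gt0 // mulr_gt0.
pose b := (tau * M ^+ 2)^-1.
have M2 : 0 < M ^+ 2 by rewrite exprn_gt0 //; lra.
have b0 : 0 < b by rewrite invr_gt0 mulr_gt0.
have P := mean_phase_potential alpha0 lambda0 massS anti m 0 0 (199 / 200) (ltW b0).
apply: (@le_trans _ _ _ _ _ _ (le_trans P _)); last first.
  apply: mean_phase_le => // v; rewrite add0n -/M.
  have [h|h] := leP (sqn (v - M *: mu)) (tau * M ^+ 2).
    apply: (@le_trans _ _ (199 / 200)).
      by rewrite lerBlDr lerDl mulr_ge0 ?sqn_ge0 // ltW.
    apply: second_phase_good => //.
    apply: le_trans (sqn_warm_start _) _; rewrite -/M.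
    have -> : M^-1 *: v - mu = M^-1 *: (v - M *: mu).
      by rewrite scalerBr scalerA mulVf ?scale1r // gt_eqF //; lra.
    rewrite sqnZ exprVn.
    have -> : 1600 / (lambda ^+ 2 * K) * eps ^+ 2 = 4 / lambda ^+ 2 * tau.
      by rewrite /tau; field; rewrite !gt_eqF.
    rewrite ler_pM2l ?divr_gt0 //.
    by rewrite mulrC ler_pdivrMr.
  apply: (@le_trans _ _ 0).
    have : 1 < b * sqn (v - M *: mu).
      by rewrite /b mulrC ltr_pdivlMr ?mul1r // mulr_gt0.
    lra.
  case: (eps < 2 * radius); last exact: good_ge0.
  rewrite -(sgd_phase_cst S q1 radius s (J * d%:R) (warm_start lambda m v) m 0 0 (warm_start lambda m v)).
  by apply: sgd_phase_le => // z; apply: good_ge0.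
rewrite -/M scale0r subr0 /sqn big1 => [|i _]; last by rewrite mxE expr0n.
rewrite add0r.
suff : b * (M * d%:R) <= 1 / 200 by lra.
have hM : K * d%:R <= 2 * (M * eps ^+ 2).
  have : K * (d%:R / eps ^+ 2) < M + 1 by rewrite /M natr1; apply: truncnS_gt.
  by move=> /ler_trunc_double /(_ M1); rewrite [K * (_ / _)]mulrA ler_pdivrMr // [2 * (M * _)]mulrA.
have Mp : 0 < M by apply: lt_le_trans M1.
rewrite /b mulrC ler_pdivrMr ?mulr_gt0 ?invr_gt0 // /tau.
have -> : 1 / 200 * (400 * eps ^+ 2 / K * M ^+ 2) = M * (2 * (M * eps ^+ 2) / K).
  by field; rewrite gt_eqF.
by rewrite ler_pM2l // ler_pdivlMr // mulrC.
Qed.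

End Correctness.

(** * Lower bounds on expectations of program runs *)

Section Semantics.
Context {R : realType} {d : nat}.
Variables (q : cube d -> R) (S : {set cube d}).
Hypotheses (q0 : forall x, 0 <= q x) (q1 : \sum_(x : cube d) q x = 1).

Definition expect A (D : fdist (R := R) A) (f : A -> R) : R := \sum_(o <- D) o.1 * f o.2.

Lemma expect_ret A (a : A) (f : A -> R) : expect (fret (R := R) a) f = f a.
Proof. by rewrite /expect big_seq1 mul1r. Qed.

Lemma expect_bind A B (D : fdist (R := R) A) (g : A -> fdist (R := R) B) (f : B -> R) :
  expect (fbind D g) f = expect D (fun a => expect (g a) f).
Proof.
rewrite /expect /fbind big_flatten big_map; apply: eq_bigr => o _.
by rewrite big_map mulr_sumr; apply: eq_bigr => o' _; rewrite mulrA.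
Qed.

Lemma expect_sample A (g : cube d -> A) (f : A -> R) :
  expect [seq (q x, g x) | x <- enum (cube d)] f = \sum_(x : cube d) q x * f (g x).
Proof. by rewrite /expect big_map big_enum. Qed.

Lemma coin_bounds (p : R) : 0 <= Num.max 0 (Num.min 1 p) <= 1.
Proof. by rewrite le_max lexx /= ge_max ler01 ge_min lexx. Qed.

Lemma expect_step_le (cf : config) (f g : config -> R) :
  (forall c, f c <= g c) -> expect (step q S cf) f <= expect (step q S cf) g.
Proof.
move=> h; case: cf => l [rg m ns nq].
case: l => [|[|c1 c2|b c1 c2|b c1|r e|a e|r e|a|r a] k] /=; rewrite ?expect_ret //.
- have /andP[p0 p1] := coin_bounds (reval (State rg m ns nq) e).
  rewrite /expect !big_cons !big_nil !addr0 /=.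
  by apply: lerD; apply: ler_wpM2l => //; rewrite subr_ge0.
- by rewrite !expect_sample; apply: ler_sum => x _; apply: ler_wpM2l.
Qed.

Lemma expect_step_cst (cf : config) (c : R) : expect (step q S cf) (fun=> c) = c.
Proof.
case: cf => l [rg m ns nq].
case: l => [|[|c1 c2|b c1 c2|b c1|r e|a e|r e|a|r a] k] /=; rewrite ?expect_ret //.
- by rewrite /expect !big_cons !big_nil !addr0 /= -mulrDl addrC subrK mul1r.
- by rewrite expect_sample -mulr_suml q1 mul1r.
Qed.

Lemma expect_exec_le t (cf : config) (f g : config -> R) :
  (forall c, f c <= g c) -> expect (exec q S t cf) f <= expect (exec q S t cf) g.
Proof.
move=> h; elim: t cf => [|t IH] cf /=; first by rewrite !expect_ret.
by rewrite !expect_bind; apply: expect_step_le.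
Qed.

Lemma expect_exec_cst t (cf : config) (c : R) : expect (exec q S t cf) (fun=> c) = c.
Proof.
elim: t cf => [|t IH] cf /=; first by rewrite expect_ret.
by rewrite expect_bind; under eq_fun do rewrite IH; rewrite expect_step_cst.
Qed.

(** A quantitative weakest-precondition judgement: from [cf], at any time from [T] on, the
    expectation of [f] over halted runs is at least [v]. As halted configurations stay put, [T] need
    only be an upper bound on the running time. *)
Definition runs (f : state (R := R) -> R) (T : nat) (cf : config) (v : R) : Prop :=
  forall t, (T <= t)%N ->
    v <= expect (exec q S t cf) (fun c => (halted c)%:R * f c.2).

Section Rules.
Variable f : state (R := R) -> R.
Implicit Types (T : nat) (k : seq com) (s : state (R := R)) (v : R).

Lemma runs_nil T s : runs f T ([::], s) (f s).
Proof.
move=> t _; elim: t => [|t IH] /=; first by rewrite expect_ret /= mul1r.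
by rewrite expect_bind; case: s IH => rg m ns nq IH /=; rewrite expect_ret.
Qed.

Lemma runs_le T T' cf v v' : runs f T cf v -> (T <= T')%N -> v' <= v -> runs f T' cf v'.
Proof. by move=> h hT hv t ht; apply: le_trans hv (h t (leq_trans hT ht)). Qed.

Lemma runs_step T cf cf' v : step q S cf = fret (R := R) cf' -> runs f T cf' v -> runs f T.+1 cf v.
Proof. by move=> e h [//|t] ht /=; rewrite expect_bind e expect_ret; apply: h. Qed.

Lemma runs_skip T k s v : runs f T (k, s) v -> runs f T.+1 (Skip :: k, s) v.
Proof. by apply: runs_step; case: s. Qed.

Lemma runs_seq T c1 c2 k s v : runs f T (c1 :: c2 :: k, s) v -> runs f T.+1 (Seq c1 c2 :: k, s) v.
Proof. by apply: runs_step; case: s. Qed.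

Lemma runs_if T b c1 c2 k s v :
  (beval s b -> runs f T (c1 :: k, s) v) -> (~~ beval s b -> runs f T (c2 :: k, s) v) ->
  runs f T.+1 (If b c1 c2 :: k, s) v.
Proof.
move=> h1 h2; apply: (@runs_step _ _ ((if beval s b then c1 else c2) :: k, s)).
  by case: s {h1 h2}.
by case: ifP h1 h2 => _ h1 h2; [apply: h1|apply: h2].
Qed.

Lemma runs_while_true T b c k s v : beval s b ->
  runs f T (c :: While b c :: k, s) v -> runs f T.+1 (While b c :: k, s) v.
Proof. by move=> e; apply: runs_step; case: s e => rg m ns nq e /=; rewrite e. Qed.

Lemma runs_while_false T b c k s v : ~~ beval s b ->
  runs f T (k, s) v -> runs f T.+1 (While b c :: k, s) v.
Proof. by move=> e; apply: runs_step; case: s e => rg m ns nq /negbTE e /=; rewrite e. Qed.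

Lemma runs_seti T r e k s v :
  runs f T (k, State (upd (reg s) r (ieval s e)) (Defs.mem s) (nsamples s) (nqueries s)) v ->
  runs f T.+1 (SetI r e :: k, s) v.
Proof. by apply: runs_step; case: s. Qed.

Lemma runs_setr T a e k s v :
  runs f T (k, State (reg s) (upd (Defs.mem s) (ieval s a) (reval s e)) (nsamples s) (nqueries s)) v ->
  runs f T.+1 (SetR a e :: k, s) v.
Proof. by apply: runs_step; case: s. Qed.

Lemma runs_query T r a k s v :
  runs f T (k, State (upd (reg s) r (read_cube (Defs.mem s) (ieval s a) \in S)) (Defs.mem s)
              (nsamples s) (nqueries s).+1) v ->
  runs f T.+1 (Query r a :: k, s) v.
Proof. by apply: runs_step; case: s. Qed.

Lemma runs_coin T r e k s (v : bool -> R) : 0 <= reval s e <= 1 ->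
  (forall b, runs f T (k, State (upd (reg s) r (nat_of_bool b)) (Defs.mem s) (nsamples s) (nqueries s)) (v b)) ->
  runs f T.+1 (Coin r e :: k, s) (reval s e * v true + (1 - reval s e) * v false).
Proof.
move=> /andP[p0 p1] h [//|t] ht; case: s p0 p1 h => rg m ns nq p0 p1 h /=.
have -> : Num.max 0 (Num.min 1 (reval (State rg m ns nq) e)) = reval (State rg m ns nq) e.
  by rewrite min_r // max_r.
rewrite expect_bind {1}/expect !big_cons !big_nil !addr0 /=.
by apply: lerD; apply: ler_wpM2l; rewrite ?subr_ge0 //; [apply: (h true)|apply: (h false)].
Qed.

Lemma runs_sample T a k s (v : cube d -> R) :
  (forall x, runs f T (k, State (reg s) (write_cube (Defs.mem s) (ieval s a) x) (nsamples s).+1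
               (nqueries s)) (v x)) ->
  runs f T.+1 (Sample a :: k, s) (\sum_(x : cube d) q x * v x).
Proof.
move=> h [//|t] ht; case: s h => rg m ns nq h /=.
by rewrite expect_bind expect_sample; apply: ler_sum => x _; apply: ler_wpM2l => //; apply: h.
Qed.

End Rules.

(** * Counting loops, memory blocks and coin tossing *)

Definition Loop (r : nat) (n : iexp) (body : com) : com :=
  Seq (SetI r (INum 0))
    (While (BNot (BLeqI n (IReg r))) (Seq body (SetI r (IAdd (IReg r) (INum 1))))).

Definition setreg (r j : nat) (s : state (R := R)) : state (R := R) :=
  State (upd (reg s) r j) (Defs.mem s) (nsamples s) (nqueries s).

Section Loops.
Variable f : state (R := R) -> R.

Definition bump (r : nat) (s : state (R := R)) : state (R := R) := setreg r (reg s r).+1 s.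

Lemma upd_same A (g : nat -> A) i a : upd g i a i = a.
Proof. by rewrite /upd eqxx. Qed.

(** [V j s] bounds from below the value of entering iteration [j] in state [s]. The body is verified
    for an arbitrary continuation, since the rest of the loop is on the control stack. Each
    iteration costs 3 steps beyond the body (test, sequencing, increment); entry and exit cost 3
    more. *)
Lemma runs_loop r e n tb body T k s (Inv : nat -> state (R := R) -> Prop) (V : nat -> state (R := R) -> R) :
  (forall j s, Inv j s -> reg s r = j /\ ieval s e = n) ->
  (forall j s T' k', (j < n)%N -> Inv j s ->
     (forall s', Inv j.+1 (bump r s') -> runs f T' (k', s') (V j.+1 (bump r s'))) ->
     runs f (T' + tb) (body :: k', s) (V j s)) ->
  (forall s, Inv n s -> runs f T (k, s) (V n s)) ->
  Inv 0 (setreg r 0 s) ->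
  runs f (T + (n * (tb + 3) + 3)) (Loop r e body :: k, s) (V 0 (setreg r 0 s)).
Proof.
move=> hI hb he h0.
have main i : forall j s, (j + i = n)%N -> Inv j s ->
    runs f (T + (i * (tb + 3) + 1)) (While (BNot (BLeqI e (IReg r)))
      (Seq body (SetI r (IAdd (IReg r) (INum 1)))) :: k, s) (V j s).
  elim: i => [|i IH] j s' ji hj; have [hr hn] := hI _ _ hj.
    rewrite mul0n add0n addn1; apply: runs_while_false.
      by rewrite /= hr hn negbK -ji addn0.
    by move: hj; have -> : j = n by [rewrite -ji addn0]; apply: he.
  have lt : (j < n)%N by lia.
  have hi := hb j s' (T + (i * (tb + 3) + 1)).+1 _ lt hj.
  apply: (@runs_le _ ((T + (i * (tb + 3) + 1)).+1 + tb).+2); [|lia|exact: lexx].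
  apply: runs_while_true; first by rewrite /= hr hn -ltnNge.
  apply: runs_seq; apply: hi => s'' hs''.
  apply: runs_seti; rewrite /= [(reg s'' r + 1)%N]addn1.
  by apply: IH => //; lia.
apply: (@runs_le _ (T + (n * (tb + 3) + 1)).+2); [|lia|exact: lexx].
by apply: runs_seq; apply: runs_seti; apply: main.
Qed.

Lemma upd_upd A (g : nat -> A) i a b : upd (upd g i a) i b = upd g i b.
Proof. by apply/funext => j; rewrite /upd; case: (j == i). Qed.

Lemma runs_loop_det r e n tb body T k rg (mm : nat -> nat -> R) ns nq v :
  (forall j, ieval (State (upd rg r j) (mm j) ns nq) e = n) ->
  (forall j T' k', (j < n)%N ->
     runs f T' (k', State (upd rg r j) (mm j.+1) ns nq) v ->
     runs f (T' + tb) (body :: k', State (upd rg r j) (mm j) ns nq) v) ->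
  runs f T (k, State (upd rg r n) (mm n) ns nq) v ->
  runs f (T + (n * (tb + 3) + 3)) (Loop r e body :: k, State rg (mm 0) ns nq) v.
Proof.
move=> he hb hx.
apply: (@runs_loop r e n tb body T k _ (fun j s => s = State (upd rg r j) (mm j) ns nq) (fun _ _ => v)).
- by move=> j s ->; rewrite he /= upd_same.
- move=> j s T' k' jn -> h; apply: hb => //; apply: h.
  by rewrite /bump /setreg /= upd_same upd_upd.
- by move=> s ->.
- by [].
Qed.

Definition blk (m : nat -> R) (b n : nat) (g : nat -> R) : nat -> R :=
  fun a => if (b <= a < b + n)%N then g (a - b)%N else m a.

Lemma blk0 m b g : blk m b 0 g = m.
Proof. by apply/funext => a; rewrite /blk; case: ifP => //; lia. Qed.

Lemma blkS m b n g : upd (blk m b n g) (b + n) (g n) = blk m b n.+1 g.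
Proof.
apply/funext => a; rewrite /blk /upd; case: eqP => [->|ne].
  by rewrite leq_addr addnS ltnS leqnn addKn.
by congr (if _ then _ else _); lia.
Qed.

Lemma blk_in m b n g i : (i < n)%N -> blk m b n g (b + i) = g i.
Proof. by move=> h; rewrite /blk leq_addr ltn_add2l h addKn. Qed.

Lemma blk_out m b n g a : (a < b)%N || (b + n <= a)%N -> blk m b n g a = m a.
Proof. by move=> h; rewrite /blk; case: ifP => //; lia. Qed.

Definition rd (m : nat -> R) (b : nat) : 'rV[R]_d := \row_(i < d) m (b + i)%N.

Definition bitsn (x : cube d) (i : nat) : R := oapp (fun i : 'I_d => (x i)%:R) 0 (insub i).

Lemma bitsnE x (i : 'I_d) : bitsn x i = (x i)%:R.
Proof. by rewrite /bitsn valK. Qed.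

Lemma write_cubeE m b (x : cube d) : write_cube m b x = blk m b d (bitsn x).
Proof.
apply/funext => a; rewrite /write_cube /blk /bitsn; case: (leqP b a) => //= h.
have -> : (a < b + d)%N = (a - b < d)%N by lia.
by case: insubP => [i -> _|/negbTE ->].
Qed.

Lemma read_bits m b x : read_cube (blk m b d (bitsn x)) b = x.
Proof.
apply/ffunP => i; rewrite ffunE blk_in // bitsnE.
by case: (x i); rewrite ?oner_eq0 ?eqxx.
Qed.

Lemma rd_out m b n g b' : (b' + d <= b)%N || (b + n <= b')%N -> rd (blk m b n g) b' = rd m b'.
Proof. by move=> h; apply/rowP => i; rewrite !mxE blk_out //; have := ltn_ord i; lia. Qed.

Lemma upd_comm A (g : nat -> A) i j a b : i != j ->
  upd (upd g i a) j b = upd (upd g j b) i a.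
Proof.
move=> /eqP ne; apply/funext => l; rewrite /upd.
by case: (l =P i); case: (l =P j) => // -> e; case: ne.
Qed.

Lemma upd_id A (g : nat -> A) i : upd g i (g i) = g.
Proof. by apply/funext => j; rewrite /upd; case: eqP => [->|]. Qed.

Lemma eq_blk m b n g g' : (forall i, (i < n)%N -> g i = g' i) -> blk m b n g = blk m b n g'.
Proof. by move=> h; apply/funext => a; rewrite /blk; case: ifP => // ?; apply: h; lia. Qed.

Lemma bool_eqR (b c : bool) : ((b%:R : R) == c%:R) = (b == c).
Proof. by case: b; case: c; rewrite ?eqxx // ?oner_eq0 // eq_sym oner_eq0. Qed.

Definition coin_loop (eb : iexp) (p : rexp) : com :=
  Loop 3 (IReg 0) (Seq (Coin 4 p) (SetR (IAdd eb (IReg 3)) (RNat (IReg 4)))).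

(** Independent coins of parameters [sigmoid (z 0 i)] produce a point of law [prodD z]; register 4
    ends with the last coin, hence the arbitrary [b4]. *)
Lemma runs_coins (z : 'rV[R]_d) eb b p T k (rg : nat -> nat) m ns nq (v : cube d -> R) :
  rg 0%N = d ->
  (forall j b4 (c : nat -> R), ieval (State (upd (upd rg 4 b4) 3 j) c ns nq) eb = b) ->
  (forall (i : 'I_d) b4 c, reval (State (upd (upd rg 4 b4) 3 i) (blk m b i c) ns nq) p = sigmoid (z 0 i)) ->
  (forall b4 x, runs f T (k, State (upd (upd rg 4 b4) 3 d) (blk m b d (bitsn x)) ns nq) (v x)) ->
  runs f (T + (d * 6 + 3)) (coin_loop eb p :: k, State rg m ns nq)
    (\sum_(x : cube d) prodD z x * v x).
Proof.
move=> hd heb hp hv.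
pose Inv j (s : state (R := R)) := exists b4 (c : nat -> bool),
  s = State (upd (upd rg 4 b4) 3 j) (blk m b j (fun i => (c i)%:R)) ns nq.
(* Coordinates already drawn contribute the indicator that they agree with [x], the others their
   Bernoulli weight. At [j = 0] the product is [prodD z x]; at [j = d] only the drawn point
   survives. *)
pose F j (s : state (R := R)) (x : cube d) (i : 'I_d) : R :=
  if (i < j)%N then (Defs.mem s (b + i)%N == (x i)%:R)%R%:R
  else if x i then sigmoid (z 0 i) else 1 - sigmoid (z 0 i).
pose V j s := \sum_(x : cube d) (\prod_(i < d) F j s x i) * v x.
have -> : \sum_(x : cube d) prodD z x * v x = V 0%N (setreg 3 0 (State rg m ns nq)).
  by apply: eq_bigr => x _; rewrite prodD_sigmoid.
have -> : (d * 6 + 3 = d * (3 + 3) + 3)%N by lia.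
apply: (@runs_loop _ _ _ _ _ _ _ _ Inv V).
- by move=> j s [b4 [c ->]].
- move=> j ? T' k' jn [b4 [c ->]] h.
  set s := State _ _ _ _; pose o : 'I_d := Ordinal jn.
  pose c' bb := upd c j bb.
  pose s' bb := State (upd (upd rg 4 (nat_of_bool bb)) 3 j)
     (blk m b j.+1 (fun i => (c' bb i)%:R)) ns nq.
  have hVs : V j s = reval s p * V j.+1 (bump 3 (s' true)) + (1 - reval s p) * V j.+1 (bump 3 (s' false)).
    rewrite /V !mulr_sumr -big_split; apply: eq_bigr => x _ /=.
    rewrite !mulrA -mulrDl; congr (_ * _).
    rewrite (bigD1 o) //= [X in _ = _ * X + _](bigD1 o) //= [X in _ = _ + _ * X](bigD1 o) //=.
    have e bb : \prod_(i < d | i != o) F j.+1 (bump 3 (s' bb)) x i = \prod_(i < d | i != o) F j s x i.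
      apply: eq_bigr => i io; have ij : (i : nat) != j by [].
      rewrite /F ltnS leq_eqVlt (negbTE ij) /=; case: ltnP => // lt.
      by rewrite !blk_in ?(ltnW lt) // ?leqW // /c' /upd (negbTE ij).
    rewrite !e !mulrA -mulrDl; congr (_ * _).
    rewrite /F ltnn ltnS leqnn /= !blk_in // /c' !upd_same !bool_eqR.
    rewrite (hp o) /=.
    by case: (x o) => /=; rewrite ?mulr1 ?mulr0 ?addr0 ?add0r.
  rewrite hVs; apply: (@runs_le _ T'.+3); [|lia|exact: lexx].
  apply: runs_seq; apply: (@runs_coin _ _ _ _ _ _ (fun bb => V j.+1 (bump 3 (s' bb)))).
    by rewrite (hp o); have /andP[h1 h2] := sigmoid_bounds (z 0 o); rewrite !ltW.
  move=> bb; apply: runs_setr.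
  have es : State (reg (State (upd (reg s) 4 (nat_of_bool bb)) (Defs.mem s) (nsamples s) (nqueries s)))
    (upd (Defs.mem s) (ieval (State (upd (reg s) 4 (nat_of_bool bb)) (Defs.mem s) (nsamples s) (nqueries s)) (IAdd eb (IReg 3)))
       (nat_of_bool bb)%:R) ns nq = s' bb.
    rewrite /s' /= [upd (upd (upd _ _ _) _ _) _ _]upd_comm // upd_upd heb upd_same; congr State.
    rewrite -blkS /c' upd_same; congr upd.
    by apply: eq_blk => i ij; rewrite /upd ltn_eqF.
  rewrite /= -/s in es *; rewrite /= upd_same in es *.
  rewrite es; apply: h; exists (nat_of_bool bb), (c' bb).
  by rewrite /bump /setreg /= upd_same upd_upd.
- move=> s [b4 [c ->]].
  pose x0 : cube d := [ffun i : 'I_d => c i].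
  have -> : blk m b d (fun i => (c i)%:R) = blk m b d (bitsn x0).
    by apply: eq_blk => i id; rewrite -[i]/(val (Ordinal id)) bitsnE ffunE.
  apply: runs_le (hv b4 x0) _ _ => //.
  set s' := State _ _ _ _; rewrite /V (bigD1 x0) //=.
  have -> : \prod_(i < d) F d s' x0 i = 1.
    by apply: big1 => i _; rewrite /F ltn_ord /= blk_in // bitsnE eqxx.
  rewrite mul1r [X in _ + X]big1 ?addr0 // => x xx0.
  have [i hi] : exists i, x i != x0 i.
    by apply/existsP; apply: contraNT xx0; rewrite negb_exists => /forallP h;
       apply/eqP/ffunP => i; apply/eqP; rewrite -[_ == _]negbK h.
  rewrite (bigD1 i) //= /F ltn_ord /= blk_in // bitsnE bool_eqR eq_sym (negbTE hi).
  by rewrite !mul0r.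
exists (rg 4%N), (fun=> false); rewrite /setreg /= blk0 upd_id //.
Qed.

End Loops.
End Semantics.

(** * The program *)

Section Program.
Variables (eR eS eJ eK : rexp).

(* Cells 0, 1, 2 hold eps, alpha, lambda and cell 3 the value of [Hub (Z - A)].
   From cell 4 on there are four blocks of d cells: the iterate Z, the
   starting point A, and the points X (from coins) and Y (from the sampler).
   Registers: 0 the dimension, 1 the number of samples per phase, 2 and 3 the
   outer and inner loop counters, 4 a coin or an answer of the oracle. *)
Definition iZ : iexp := INum 4.
Definition iA : iexp := IAdd iZ (IReg 0).
Definition iX : iexp := IAdd iA (IReg 0).
Definition iY : iexp := IAdd iX (IReg 0).
Definition cell (b : iexp) : rexp := RCell (IAdd b (IReg 3)).
Definition num (n : nat) : rexp := RNat (INum n).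
Definition vec (b : iexp) (e : rexp) : com := Loop 3 (IReg 0) (SetR (IAdd b (IReg 3)) e).

(** Reals are not converted to registers directly: counting up from 0 stops at the integer part, in
    time proportional to the result. *)
Definition floor_loop (e : rexp) : com :=
  While (BNot (BLtR e (RNat (IAdd (IReg 1) (INum 1))))) (SetI 1 (IAdd (IReg 1) (INum 1))).

Definition sum_loop : com :=
  Loop 2 (IReg 1) (Seq (Sample iY) (vec iA (RAdd (cell iA) (cell iY)))).

Definition eLam : rexp := RCell (INum 2).

Definition warm_loop : com :=
  Loop 3 (IReg 0)
    (Seq (SetR (IAdd iA (IReg 3)) (RDiv (cell iA) (RNat (IReg 1))))
    (Seq (If (BLtR (cell iA) eLam) (SetR (IAdd iA (IReg 3)) eLam)
         (If (BLtR (RSub (num 1) eLam) (cell iA))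
           (SetR (IAdd iA (IReg 3)) (RSub (num 1) eLam)) Skip))
      (SetR (IAdd iA (IReg 3)) (RLn (RDiv (cell iA) (RSub (num 1) (cell iA))))))).

Definition eDev : rexp := RSub (cell iZ) (cell iA).
Definition eJap : rexp := RExp (RDiv (RLn (RAdd (num 1) (RMul eDev eDev))) (num 2)).

Definition hub_loop : com :=
  Loop 3 (IReg 0) (SetR (INum 3) (RAdd (RCell (INum 3)) (RSub eJap (num 1)))).

Definition pull_loop : com := vec iZ (RSub (cell iZ) (RDiv (RDiv eDev eJap) (num 4))).

Definition step_loop : com :=
  vec iZ (RSub (cell iZ)
    (RMul (RMul (RDiv eS (RAdd (RNat (IReg 2)) (RMul eJ (RNat (IReg 0))))) (RNat (IReg 4)))
       (RSub (cell iX) (cell iY)))).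

Definition eSig : rexp := RDiv (RExp (cell iZ)) (RAdd (num 1) (RExp (cell iZ))).

Definition sgd_iteration : com :=
  Seq (Sample iY)
  (Seq (coin_loop iX eSig)
  (Seq (Query 4 iX)
  (Seq (SetR (INum 3) (num 0))
  (Seq hub_loop
  (If (BLtR (RMul (num 2) eR) (RCell (INum 3))) pull_loop step_loop))))).

Definition program : com :=
  Seq (floor_loop (RMul eK (RDiv (RNat (IReg 0)) (RMul (RCell (INum 0)) (RCell (INum 0))))))
  (Seq sum_loop
  (Seq warm_loop
  (Seq (vec iZ (cell iA))
  (Seq (If (BLtR (RCell (INum 0)) (RMul (num 2) eR)) (Loop 2 (IReg 1) sgd_iteration) Skip)
  (vec (INum 0) (cell iZ)))))).

(** * The program realises the functional [algorithm] *)

Section Spec.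
Context {R : realType} {d : nat}.
Variables (q : cube d -> R) (S : {set cube d}).
Hypotheses (q0 : forall x, 0 <= q x) (q1 : \sum_(x : cube d) q x = 1).
Variables (eps alpha lambda radius s J K : R).
Hypothesis lambda0 : 0 < lambda.

Definition params (mm : nat -> R) := [/\ mm 0%N = eps, mm 1%N = alpha & mm 2%N = lambda].

Hypothesis hR : forall st, params (Defs.mem st) -> reval st eR = radius.
Hypothesis hS : forall st, params (Defs.mem st) -> reval st eS = s.
Hypothesis hJ : forall st, params (Defs.mem st) -> reval st eJ = J.
Hypothesis hK : forall st, params (Defs.mem st) -> reval st eK = K.

Lemma params_blk mm b n g : (3 <= b)%N -> params mm -> params (blk mm b n g).
Proof. by move=> hb [h0 h1 h2]; split; rewrite blk_out //; lia. Qed.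

Lemma params_upd mm b (t : R) : (3 <= b)%N -> params mm -> params (upd mm b t).
Proof. by move=> hb [h0 h1 h2]; split; rewrite /upd; case: eqP => // e; lia. Qed.

Variable f : state (R := R) -> R.
Local Notation Runs := (runs q S f).
Local Notation bZ := 4%N.
Local Notation bA := (4 + d)%N.
Local Notation bX := (4 + d + d)%N.
Local Notation bY := (4 + d + d + d)%N.

Lemma runs_vec eb b e g T k (rg : nat -> nat) mm ns nq v :
  rg 0%N = d ->
  (forall j (c : nat -> R), ieval (State (upd rg 3 j) c ns nq) eb = b) ->
  (forall j, (j < d)%N -> reval (State (upd rg 3 j) (blk mm b j g) ns nq) e = g j) ->
  Runs T (k, State (upd rg 3 d) (blk mm b d g) ns nq) v ->
  Runs (T + (d * 4 + 3)) (vec eb e :: k, State rg mm ns nq) v.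
Proof.
move=> hd hb he h; have -> : (d * 4 + 3 = d * (1 + 3) + 3)%N by lia.
rewrite -{1}(blk0 mm b g); apply: (runs_loop_det (mm := fun j => blk mm b j g)) => //.
move=> j T' k' jd h'; rewrite addn1; apply: runs_setr; rewrite /= hb upd_same he //.
by rewrite blkS.
Qed.

Lemma runs_floor_loop e x T k (rg : nat -> nat) mm ns nq v :
  0 <= x -> rg 1%N = 0%N ->
  (forall j, reval (State (upd rg 1 j) mm ns nq) e = x) ->
  Runs T (k, State (upd rg 1 (Num.truncn x)) mm ns nq) v ->
  Runs (T + (Num.truncn x * 2 + 1)) (floor_loop e :: k, State rg mm ns nq) v.
Proof.
move=> x0 r1 he h; set m := Num.truncn x.
have main i : forall j, (j + i = m)%N ->
    Runs (T + (i * 2 + 1)) (floor_loop e :: k, State (upd rg 1 j) mm ns nq) v.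
  elim: i => [|i IH] j ji.
    rewrite mul0n add0n addn1; apply: runs_while_false.
      rewrite /= he upd_same negbK addn1; have -> : j = m by rewrite -ji addn0.
      exact: truncnS_gt.
    by have -> : j = m by rewrite -ji addn0.
  have -> : (T + (i.+1 * 2 + 1) = (T + (i * 2 + 1)).+2)%N by lia.
  apply: runs_while_true.
    rewrite /= he upd_same addn1 -leNgt -truncn_gt_nat -/m; lia.
  apply: runs_seti; rewrite /= upd_same upd_upd [(j + 1)%N]addn1; apply: IH; lia.
have := main m 0%N (add0n _).
by have -> : upd rg 1 0%N = rg by [rewrite -[in RHS](upd_id rg 1) r1].
Qed.

Lemma runs_sum_loop m T k (rg : nat -> nat) mm ns nq (v : 'rV[R]_d -> R) :
  rg 0%N = d -> rg 1%N = m -> params mm ->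
  (forall rg' mm', rg' 0%N = d -> rg' 1%N = m -> params mm' ->
     Runs T (k, State rg' mm' (ns + m) nq) (v (rd mm' bA))) ->
  Runs (T + (m * (d * 4 + 8) + 3)) (sum_loop :: k, State rg mm ns nq)
    (mean_phase q m v (rd mm bA)).
Proof.
move=> hd hm hp h.
pose Inv j (st : state (R := R)) := [/\ reg st 0%N = d, reg st 1%N = m, reg st 2%N = j,
  params (Defs.mem st) & nsamples st = (ns + j)%N /\ nqueries st = nq].
pose V j (st : state (R := R)) := mean_phase q (m - j) v (rd (Defs.mem st) bA).
have -> : mean_phase q m v (rd mm bA) = V 0%N (setreg 2 0 (State rg mm ns nq)).
  by rewrite /V subn0.
have -> : (m * (d * 4 + 8) + 3 = m * (d * 4 + 5 + 3) + 3)%N by lia.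
apply: (runs_loop (Inv := Inv) (V := V)).
- by move=> j st [].
- move=> j [rg' mm' ns' nq'] T' k' jm [/= r0 r1 r2 p [e1 e2]] hk.
  have -> : (T' + (d * 4 + 5) = ((T' + (d * 4 + 3)).+1).+1)%N by lia.
  apply: runs_seq; rewrite /V.
  have -> : (m - j = (m - j.+1).+1)%N by lia.
  apply: runs_sample => // y /=; rewrite r0 write_cubeE.
  pose g i := mm' (bA + i)%N + blk mm' bY d (bitsn y) (bY + i)%N.
  apply: (@runs_vec _ bA _ g) => //=.
  + by move=> i c; rewrite /upd /= r0.
  + move=> i id; rewrite /upd /= r0; set M := blk mm' bY d _.
    have e a : (bA + i <= a)%N -> blk M bA i g a = M a by move=> ?; apply: blk_out; lia.
    rewrite !e /g -/M; [|lia|lia].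
    by rewrite [M (bA + i)%N]blk_out //; lia.
  set st := State _ _ _ _.
  have := hk st; rewrite /V /st /bump /setreg /=.
  have -> : rd (blk (blk mm' bY d (bitsn y)) bA d g) bA = rd mm' bA + bits y.
    by apply/rowP => i; rewrite !mxE blk_in // /g blk_in // bitsnE.
  apply; split; rewrite ?/upd /= ?r0 ?r1 ?r2 //; last by rewrite e1 addnS.
- move=> [rg' mm' ns' nq'] [/= r0 r1 r2 p [-> ->]]; rewrite /V subnn /=.
  by apply: h.
- by split => //=; rewrite addn0.
Qed.

Lemma runs_warm_loop m T k (rg : nat -> nat) mm ns nq v :
  rg 0%N = d -> rg 1%N = m -> params mm ->
  (forall rg' mm', rg' 0%N = d -> rg' 1%N = m -> params mm' ->
     rd mm' bA = warm_start lambda m (rd mm bA) :> 'rV[R]_d ->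
     Runs T (k, State rg' mm' ns nq) v) ->
  Runs (T + (d * 10 + 3)) (warm_loop :: k, State rg mm ns nq) v.
Proof.
move=> hd hm hp h.
pose g i := logit (clamp lambda (mm (bA + i)%N / m%:R)).
have -> : (d * 10 + 3 = d * (7 + 3) + 3)%N by lia.
rewrite -{1}(blk0 mm bA g); apply: (runs_loop_det (mm := fun j => blk mm bA j g)) => //.
- move=> j T' k' jd h'.
  have u0 : upd rg 3 j 0%N = d by rewrite /upd /= hd.
  have u1 : upd rg 3 j 1%N = m by rewrite /upd /= hm.
  rewrite addnC; apply: runs_seq; apply: runs_setr; rewrite /= upd_same u0 u1.
  set t := _ / _; have et : t = mm (bA + j)%N / m%:R by rewrite /t blk_out //; lia.
  have last T'' u : u = clamp lambda t -> Runs T' (k', State (upd rg 3 j) (blk mm bA j.+1 g) ns nq) v ->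
     (T'.+1 <= T'')%N ->
     Runs T'' (SetR (IAdd iA (IReg 3)) (RLn (RDiv (cell iA) (RSub (num 1) (cell iA)))) :: k',
       State (upd rg 3 j) (upd (blk mm bA j g) (bA + j) u) ns nq) v.
    move=> eu hw hT; apply: (runs_le (T := T'.+1)) => //; apply: runs_setr.
    rewrite /= upd_same u0 upd_same upd_upd.
    by rewrite eu -[ln _]/(logit _) et -/(g j) blkS.
  have lamE u : upd (blk mm bA j g) (bA + j) u 2%N = lambda.
    by have [_ _] := params_upd u (isT : (3 <= 4 + d + j)%N) (params_blk j g (isT : (3 <= 4 + d)%N) hp).
  apply: runs_seq; apply: runs_if => /=; rewrite upd_same u0 upd_same lamE => b1.
    apply: runs_setr; rewrite /= upd_same u0 lamE upd_upd.
    by apply: last => //; rewrite /clamp b1.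
  apply: runs_if => /=; rewrite upd_same u0 upd_same lamE => b2.
    apply: runs_setr; rewrite /= upd_same u0 lamE upd_upd.
    by apply: last => //; rewrite /clamp (negbTE b1) b2.
  by apply: runs_skip; apply: last => //; rewrite /clamp (negbTE b1) (negbTE b2).
apply: h => //.
by apply/rowP => i; rewrite !mxE blk_in.
Qed.

Lemma runs_hub_loop T k (rg : nat -> nat) mm ns nq v :
  rg 0%N = d ->
  Runs T (k, State (upd rg 3 d) (upd mm 3 (Hub (rd mm bZ - rd mm bA : 'rV[R]_d))) ns nq) v ->
  Runs (T + (d * 4 + 3)) (hub_loop :: k, State rg (upd mm 3 0) ns nq) v.
Proof.
move=> hd h; have -> : (d * 4 + 3 = d * (1 + 3) + 3)%N by lia.
pose u i := mm (bZ + i)%N - mm (bA + i)%N.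
have -> : upd mm 3 0 = upd mm 3 (\sum_(i < 0) hub (u i)) by rewrite big_ord0.
apply: (runs_loop_det (mm := fun j => upd mm 3 (\sum_(i < j) hub (u i)))).
- by move=> j; rewrite /= /upd /= hd.
- move=> j T' k' jd h'; rewrite addn1; apply: runs_setr.
  have u0 : upd rg 3 j 0%N = d by rewrite /upd /= hd.
  have m4 (t : R) i : upd mm 3 t (4 + i)%N = mm (4 + i)%N by [].
  rewrite /= !upd_same u0 -[(4 + d + j)%N]addnA !m4 addnA -/(u j) mulr1n -expr2 -jap_exp.
  by rewrite upd_upd -/(hub _) -(big_ord_recr j (fun i => hub (u i))).
suff -> : \sum_(i < d) hub (u i) = Hub (rd mm bZ - rd mm bA : 'rV[R]_d) by [].
by apply: eq_bigr => i _; rewrite !mxE.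
Qed.

(** Everything an iteration must preserve or count. The iterate Z is left out, being the argument of
    the value function. *)
Definition ctx (a : 'rV[R]_d) (m ns nq j : nat) (st : state (R := R)) : Prop :=
  [/\ reg st 0%N = d, reg st 1%N = m, reg st 2%N = j, params (Defs.mem st) &
   [/\ rd (Defs.mem st) bA = a, nsamples st = ns & nqueries st = nq]].

Lemma runs_sgd_iteration a m ns nq j T k st (v : 'rV[R]_d -> R) :
  ctx a m ns nq j st ->
  (forall st', ctx a m ns.+1 nq.+1 j st' -> Runs T (k, st') (v (rd (Defs.mem st') bZ))) ->
  Runs (T + (d * 14 + 18)) (sgd_iteration :: k, st)
    (\sum_(y : cube d) q y * \sum_(x : cube d) prodD (rd (Defs.mem st) bZ) x *
       v (sgd_update S radius s (J * d%:R) a j (rd (Defs.mem st) bZ) y x)).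
Proof.
case: st => rg mm ns' nq' [/= r0 r1 r2 hp [ha -> ->]] h {ns' nq'}.
have -> : (T + (d * 14 + 18) = (((((T + (d * 4 + 3)).+1 + (d * 4 + 3)).+1.+1.+1.+1.+1) + (d * 6 + 3)).+1).+1.+1)%N by lia.
apply: runs_seq; apply: runs_sample => // y /=; rewrite r0 write_cubeE.
set z := rd mm bZ; set M1 := blk mm bY d (bitsn y).
apply: runs_seq; apply: (runs_coins (b := bX) (z := z)) => //.
- by move=> i b4 c; rewrite /= /upd /= r0.
- move=> i b4 c; have id := ltn_ord i.
  rewrite /= upd_same blk_out /M1 ?blk_out /sigmoid ?mulr1n /z ?mxE //; lia.
move=> b4 x; set M2 := blk M1 bX d (bitsn x); set rx := upd (upd rg 4 b4) 3 d.
have x0 : rx 0%N = d by rewrite /rx /upd /= r0.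
apply: runs_seq; apply: runs_query; rewrite /= x0 read_bits.
set rq := upd rx 4 _.
apply: runs_seq; apply: runs_setr; rewrite /= mulr0n.
apply: runs_seq; apply: runs_hub_loop; first exact: x0.
have hz : rd M2 bZ = z by rewrite /M2 /M1 !rd_out //; lia.
have ha2 : rd M2 bA = a by rewrite /M2 /M1 !rd_out //; lia.
rewrite hz ha2; set M3 := upd M2 3 _; set rh := upd rq 3 d.
have h0 : rh 0%N = d by exact: x0.
have h2 : rh 2%N = j by exact: r2.
have h4 : rh 4%N = (x \in S) by [].
have p3 : params M3 by apply: params_upd => //; apply: params_blk => //; apply: params_blk.
have eZ (i : 'I_d) : M3 (bZ + i)%N = z 0 i by rewrite -hz mxE.
have eA (i : 'I_d) : M3 (bA + i)%N = a 0 i by rewrite -ha2 mxE /M3 /upd.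
have eX (i : 'I_d) : M3 (bX + i)%N = (x i)%:R.
  by rewrite -bitsnE /M3 /upd /= /M2 blk_in.
have eY (i : 'I_d) : M3 (bY + i)%N = (y i)%:R.
  by rewrite -bitsnE /M3 /upd /= /M2 blk_out ?/M1 ?blk_in //; lia.
have finish (g : nat -> R) : \row_(i < d) g i = sgd_update S radius s (J * d%:R) a j z y x ->
  Runs T (k, State (upd rh 3 d) (blk M3 bZ d g) ns.+1 nq.+1)
    (v (sgd_update S radius s (J * d%:R) a j z y x)).
  move=> hg; set st' := State _ _ _ _.
  have <- : rd (Defs.mem st') bZ = sgd_update S radius s (J * d%:R) a j z y x.
    by rewrite -hg; apply/rowP => i; rewrite !mxE /= blk_in.
  apply: h; split; [exact: h0|exact: r1|exact: r2|exact: params_blk|].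
  split=> //; rewrite /= rd_out; last by lia.
  by apply/rowP => i; rewrite mxE eA.
have rj i : upd rh 3 i 0%N = d by rewrite /upd /= h0.
apply: runs_if => /= b1.
  pose g i := M3 (bZ + i)%N - (M3 (bZ + i)%N - M3 (bA + i)%N) / jap (M3 (bZ + i)%N - M3 (bA + i)%N) / 4.
  apply: (@runs_vec _ bZ _ g) => //.
    move=> i id; rewrite /= !upd_same rj.
    (* The update is in place: only cells before the current one have changed, so old values are
       read. *)
    have e b : (bZ + i <= b)%N -> blk M3 bZ i g b = M3 b by move=> ?; apply: blk_out; lia.
    have eAi : blk M3 bZ i g (bA + i)%N = M3 (bA + i)%N by apply: e; lia.
    by rewrite e // eAi mulr1n -expr2 -jap_exp.
  apply: finish; rewrite /sgd_update.
  have -> : 2 * radius < Hub (z - a) by move: b1; rewrite hR // /M3 upd_same.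
  by apply/rowP => i; rewrite /pull [LHS]mxE [RHS]mxE /g eZ eA.
pose g i := M3 (bZ + i)%N - s / (j%:R + J * d%:R) * (x \in S)%:R * (M3 (bX + i)%N - M3 (bY + i)%N).
apply: (@runs_vec _ bZ _ g) => //.
  move=> i id; rewrite /= !upd_same rj.
  have e b : (bZ + i <= b)%N -> blk M3 bZ i g b = M3 b by move=> ?; apply: blk_out; lia.
  have pi : params (blk M3 bZ i g) by apply: params_blk.
  rewrite hS // hJ // [upd rh 3 i 2%N]/upd /= h2 [upd rh 3 i 4%N]/upd /= h4.
  have eXi : blk M3 bZ i g (bX + i)%N = M3 (bX + i)%N by apply: e; lia.
  have eYi : blk M3 bZ i g (bY + i)%N = M3 (bY + i)%N by apply: e; lia.
  by rewrite e // eXi eYi.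
apply: finish; rewrite /sgd_update.
have -> : 2 * radius < Hub (z - a) = false by apply: negbTE; move: b1; rewrite hR // /M3 upd_same.
by apply/rowP => i; rewrite /sgd_step [LHS]mxE [RHS]mxE /g eZ eX eY.
Qed.

Lemma runs_sgd_loop a m ns T k st (v : 'rV[R]_d -> R) :
  ctx a m ns 0 0 (setreg 2 0 st) ->
  (forall st', ctx a m (ns + m) m m st' -> Runs T (k, st') (v (rd (Defs.mem st') bZ))) ->
  Runs (T + (m * (d * 14 + 21) + 3)) (Loop 2 (IReg 1) sgd_iteration :: k, st)
    (sgd_phase S q radius s (J * d%:R) a m 0 v (rd (Defs.mem st) bZ)).
Proof.
move=> hc h.
pose V j (st : state (R := R)) :=
  sgd_phase S q radius s (J * d%:R) a (m - j) j v (rd (Defs.mem st) bZ).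
have -> : sgd_phase S q radius s (J * d%:R) a m 0 v (rd (Defs.mem st) bZ) = V 0%N (setreg 2 0 st).
  by rewrite /V subn0.
have -> : (m * (d * 14 + 21) + 3 = m * (d * 14 + 18 + 3) + 3)%N by lia.
apply: (runs_loop (Inv := fun j => ctx a m (ns + j) j j) (V := V)).
- by move=> j st' [].
- move=> j st' T' k' jm hj hk; rewrite /V; have -> : (m - j = (m - j.+1).+1)%N by lia.
  apply: runs_sgd_iteration hj _ => st'' hc''; apply: (hk st'').
  case: hc'' => c0 c1 c2 c3 [c4 c5 c6]; split => //=; rewrite ?/upd /= ?c2 //.
  by rewrite addnS.
- by move=> st' hm; rewrite /V subnn; apply: h.
- by rewrite addn0.
Qed.

(** The bound [3 * m] counts [m] samples for the mean and [m] samples with [m] queries for the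
    descent. Block A must start at 0 because the samples are summed into it. *)
Lemma runs_program (st : state (R := R)) (phi : 'rV[R]_d -> R) :
  let m := Num.truncn (K * (d%:R / eps ^+ 2)) in
  0 <= K -> reg st 0%N = d -> reg st 1%N = 0%N -> params (Defs.mem st) ->
  nsamples st = 0%N -> nqueries st = 0%N -> rd (Defs.mem st) bA = 0 :> 'rV[R]_d ->
  (forall st', (nsamples st' + nqueries st' <= 3 * m)%N ->
     phi (rd (Defs.mem st') 0) <= f st') ->
  Runs ((m + 1) * (d * 40 + 60)) ([:: program], st)
    (algorithm S q eps lambda radius s (J * d%:R) m phi).
Proof.
case: st => rg mm ns nq m K0 /= r0 r1 hp -> -> hA hf.
pose Tend := (d * 4 + 3)%N.
pose Tsgd := (Tend + (m * (d * 14 + 21) + 3)).+1.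
apply: (runs_le (T := (((((Tsgd.+1 + (d * 4 + 3)).+1 + (d * 10 + 3)).+1 + (m * (d * 4 + 8) + 3)).+1 + (m * 2 + 1)).+1)%N) _ _ (lexx _)); last first.
  by rewrite /Tsgd /Tend; nia.
apply: runs_seq; apply: runs_floor_loop => //.
- by apply: mulr_ge0 => //; apply: divr_ge0; rewrite ?sqr_ge0.
- move=> j /=; rewrite hK // [upd rg 1 j 0%N]/upd /= r0.
  by case: hp => -> _ _; rewrite -expr2.
rewrite -/m; apply: runs_seq.
rewrite /algorithm -[X in mean_phase _ _ _ X]hA.
apply: runs_sum_loop => //.
move=> rg1 mm1 s0 s1 p1; rewrite add0n.
apply: runs_seq; apply: runs_warm_loop s0 s1 p1 _ => rg2 mm2 t0 t1 p2 hw.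
set a := warm_start _ _ _ in hw *.
apply: runs_seq.
pose g i := mm2 (bA + i)%N.
apply: (@runs_vec _ bZ _ g) => //.
  move=> i id; rewrite /= !upd_same [upd rg2 3 i 0%N]/upd /= t0 blk_out //; lia.
apply: runs_seq.
have p3 : params (blk mm2 bZ d g) by apply: params_blk.
have wZ : rd (blk mm2 bZ d g) bZ = a.
  by rewrite -hw; apply/rowP => i; rewrite !mxE blk_in.
have wA : rd (blk mm2 bZ d g) bA = a by rewrite rd_out //; lia.
have final st' : reg st' 0%N = d -> (nsamples st' + nqueries st' <= 3 * m)%N ->
    Runs Tend ([:: vec (INum 0) (cell iZ)], st') (phi (rd (Defs.mem st') bZ)).
  case: st' => rg' mm' ns' nq' /= q0' hq.
  rewrite -[Tend]add0n; pose g' i := mm' (bZ + i)%N.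
  (* The output is copied four cells down in increasing order, so each cell is read before it can be
     overwritten. *)
  apply: (@runs_vec _ 0%N _ g') => //.
    by move=> i id; rewrite /= upd_same blk_out //; lia.
  have -> : rd mm' bZ = rd (blk mm' 0 d g') 0 :> 'rV[R]_d.
    by apply/rowP => i; rewrite !mxE /blk leq0n /= add0n subn0 ltn_ord.
  by apply: runs_le (runs_nil _ _ _ _) (leqnn _) (hf _ _).
apply: runs_if => /= b1; have [pe _ _] := p3; rewrite hR // pe in b1.
  rewrite b1; rewrite -{2}wZ.
  apply: runs_sgd_loop.
    by split => //=; rewrite /upd /= ?t0 ?t1.
  by move=> st' [c0 c1 c2 c3 [c4 c5 c6]]; apply: final => //; rewrite c5 c6; lia.
rewrite (negbTE b1) -wZ; apply: (runs_le (T := Tend.+1) _ _ (lexx _)); last by lia.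
by apply: runs_skip; apply: final => //=; lia.
Qed.

End Spec.
End Program.

(** * Constants *)

(** The unit of all constants: [expR (c * u)] is [2 + 1/alpha] to the power [c / lambda], the shape
    required of the sample bound. *)
Definition eU : rexp :=
  RDiv (RLn (RAdd (num 2) (RDiv (num 1) (RCell (INum 1))))) (RCell (INum 2)).
Definition eExp (n : nat) : rexp := RExp (RMul (num n) eU).

Definition estimator : com := program (RMul (num 33) eU) (eExp 604) (eExp 610) (eExp 1400).

Section Constants.
Context {R : realType}.
Variables (alpha lambda : R).
Hypotheses (alpha0 : 0 < alpha) (alpha1 : alpha <= 1) (lambda0 : 0 < lambda) (lambda2 : lambda <= 1 / 2).

Definition scale : R := ln (2 + alpha^-1) / lambda.
Let u := scale.

Lemma ln_scale : ln (2 + alpha^-1) = u * lambda.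
Proof. by rewrite /u /scale divfK // gt_eqF. Qed.

Lemma alpha_inv_ge1 : 1 <= alpha^-1.
Proof. by rewrite invf_ge1. Qed.

Lemma expR_scale : 2 + alpha^-1 = expR (u * lambda).
Proof. by rewrite -ln_scale lnK // posrE; have := alpha_inv_ge1; lra. Qed.

Lemma scale_lambda : 1 / 2 <= u * lambda.
Proof.
rewrite -ler_expR -expR_scale; apply: le_trans (expR_le_lin _) _.
  by apply/andP; split; lra.
by have := alpha_inv_ge1; lra.
Qed.

Lemma lambda_inv : lambda^-1 <= 2 * u.
Proof.
have h := scale_lambda; rewrite -div1r ler_pdivrMr //; lra.
Qed.

Lemma scale_ge1 : 1 <= u.
Proof. by have h := scale_lambda; have l0 := lambda0; have l2 := lambda2; nra. Qed.

Lemma const_le_exp (c : R) : 1 <= c -> c <= expR (c * u).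
Proof.
move=> c1; have u1 := scale_ge1.
by apply: le_trans (expR_ge1Dx _); nra.
Qed.

Lemma scale_le_exp (c : R) : c * u <= expR (c * u).
Proof. by apply: le_trans (expR_ge1Dx _); rewrite lerDr. Qed.

Lemma radius_ge : 32 / lambda * ln alpha^-1 + 1 <= 33 * u.
Proof.
have u1 := scale_ge1.
have h : ln alpha^-1 / lambda <= u.
  rewrite ler_pM2r ?invr_gt0 // ler_ln ?posrE ?invr_gt0 //; first by lra.
  by have := alpha_inv_ge1; lra.
have -> : 32 / lambda * ln alpha^-1 = 32 * (ln alpha^-1 / lambda) by ring.
lra.
Qed.

(** After inversion the factors are at most [expR] of [8 * u], [u], [u / 2] and [594 * u], where
    [594 = 18 * 33]; the sum stays below [604 * u]. *)
Lemma curvature_ge : (expR (604 * u))^-1 <=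
  lambda ^+ 4 * alpha ^+ 2 / ((1 + alpha^-1) * expR (18 * (33 * u))).
Proof.
have u1 := scale_ge1; have al := alpha_inv_ge1; have l0 := lambda0.
have half : expR (u * lambda) <= expR (u / 2).
  by rewrite ler_expR; have := lambda2; nra.
have e2 : 1 + alpha^-1 <= expR (u / 2).
  by apply: le_trans half; rewrite -expR_scale; lra.
have e1 : alpha^-1 <= expR (u / 2) by apply: le_trans e2; lra.
have e3 : lambda^-1 <= expR (2 * u) by apply: le_trans lambda_inv (scale_le_exp _).
have L0 : 0 <= lambda^-1 by rewrite invr_ge0 ltW.
have a0 : 0 <= alpha^-1 by rewrite invr_ge0 ltW.
have -> : lambda ^+ 4 * alpha ^+ 2 / ((1 + alpha^-1) * expR (18 * (33 * u))) =
    ((lambda^-1 ^+ 4 * alpha^-1 ^+ 2) * ((1 + alpha^-1) * expR (18 * (33 * u))))^-1.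
  by rewrite [RHS]invfM (invfM (lambda^-1 ^+ 4)) -!exprVn !invrK.
rewrite lef_pV2 ?posrE ?expR_gt0 //; last first.
  by rewrite !mulr_gt0 ?exprn_gt0 ?invr_gt0 ?expR_gt0 //; lra.
apply: (@le_trans _ _ ((expR (2 * u) ^+ 4 * expR (u / 2) ^+ 2) *
    (expR (u / 2) * expR (18 * (33 * u))))).
  apply: ler_pM; last by rewrite ler_wpM2r // expR_ge0.
  - by apply: mulr_ge0; apply: exprn_ge0.
  - by apply: mulr_ge0; [lra|exact: expR_ge0].
  apply: ler_pM; [exact: exprn_ge0|exact: exprn_ge0| |];
    by rewrite lerXn2r ?nnegrE ?expR_ge0.
rewrite -!expRM_natl -!expRD ler_expR; lra.
Qed.

Lemma time_radius_ge : 784 * (33 * u) <= expR (610 * u).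
Proof.
have u1 := scale_ge1.
have h1 : 28 <= expR (28 * u) by apply: const_le_exp; lra.
have h3 : 33 * u <= expR (33 * u) := scale_le_exp _.
apply: (@le_trans _ _ (expR (28 * u) ^+ 2 * expR (33 * u))).
  have -> : 784 * (33 * u) = 28 ^+ 2 * (33 * u) :> R by ring.
  by apply: ler_pM; [exact: sqr_ge0|lra|rewrite lerXn2r ?nnegrE ?expR_ge0|].
by rewrite -!expRM_natl -!expRD ler_expR; lra.
Qed.

Lemma count_radius_ge : 6400 * (33 * u) ^+ 2 / lambda ^+ 2 <= expR (1400 * u).
Proof.
have u1 := scale_ge1; have l0 := lambda0.
have h1 : 80 <= expR (80 * u) by apply: const_le_exp; lra.
have h3 : 33 * u <= expR (33 * u) := scale_le_exp _.
have e3 : lambda^-1 <= expR (2 * u) by apply: le_trans lambda_inv (scale_le_exp _).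
have L0 : 0 <= lambda^-1 by rewrite invr_ge0 ltW.
have -> : 6400 * (33 * u) ^+ 2 / lambda ^+ 2 = (80 * (33 * u) * lambda^-1) ^+ 2.
  by field; rewrite gt_eqF.
apply: (@le_trans _ _ ((expR (80 * u) * expR (33 * u) * expR (2 * u)) ^+ 2)).
  have r0 : 0 <= 33 * u by lra.
  have p : 0 <= 80 * (33 * u) by lra.
  rewrite lerXn2r ?nnegrE //; first exact: mulr_ge0.
    by rewrite !mulr_ge0 ?expR_ge0.
  by apply: ler_pM => //; apply: ler_pM.
by rewrite -!expRD -!expRM_natl ler_expR; lra.
Qed.

(** The most demanding condition on the exponent 1400: it needs [2 * 80 + 2 * 604 = 1368]. *)
Lemma count_s_ge : 3200 * expR (604 * u) ^+ 2 <= expR (1400 * u).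
Proof.
have u1 := scale_ge1.
have h1 : 80 <= expR (80 * u) by apply: const_le_exp; lra.
apply: (@le_trans _ _ (expR (80 * u) ^+ 2 * expR (604 * u) ^+ 2)).
  rewrite ler_wpM2r ?sqr_ge0 //; apply: (@le_trans _ _ (80 ^+ 2)); first by lra.
  by rewrite lerXn2r ?nnegrE ?expR_ge0.
by rewrite -!expRM_natl -!expRD ler_expR; lra.
Qed.

Lemma count_time_ge : 140 * (33 * u) ^+ 2 * expR (610 * u) <= expR (1400 * u).
Proof.
have u1 := scale_ge1.
have h1 : 140 <= expR (140 * u) by apply: const_le_exp; lra.
have h3 : 33 * u <= expR (33 * u) := scale_le_exp _.
apply: (@le_trans _ _ (expR (140 * u) * expR (33 * u) ^+ 2 * expR (610 * u))).
  rewrite ler_wpM2r ?expR_ge0 //; apply: ler_pM => //; first exact: sqr_ge0.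
  by rewrite lerXn2r ?nnegrE ?expR_ge0 //; lra.
by rewrite -!expRM_natl -!expRD ler_expR; lra.
Qed.

End Constants.

Section Interpretation.
Context {R : realType}.

Lemma reval_eExp (n : nat) (eps alpha lambda : R) (st : state) :
  params eps alpha lambda (Defs.mem st) -> reval st (eExp n) = expR (n%:R * scale alpha lambda).
Proof.
by move=> [_ h1 h2]; rewrite /= h1 h2 /scale mulr1n div1r.
Qed.

Lemma reval_radius (eps alpha lambda : R) (st : state) :
  params eps alpha lambda (Defs.mem st) -> reval st (RMul (num 33) eU) = 33 * scale alpha lambda.
Proof.
by move=> [_ h1 h2]; rewrite /= h1 h2 /scale mulr1n div1r.
Qed.

End Interpretation.

(** * Assembly of sample, time and accuracy bounds *)

Theorem theorem4 (R : realType) :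
  exists (A : com) (P Q T : {poly R}) (C C' : R) (k : nat),
    P \is a polyOver Num.nneg /\ Q \is a polyOver Num.nneg /\
    forall (d : nat) (eps alpha lambda : R) (S : {set cube d}) (zs : 'rV[R]_d),
      0 < eps -> 0 < alpha -> 0 < lambda ->
      alpha <= mass (prodD zs) S ->
      anti_concentrated (prodD_trunc zs S) lambda ->
      let N := sample_bound P Q C k d eps alpha lambda in
      exists t : nat,
        let D := exec (prodD_trunc zs S) S t (init A d eps alpha lambda) in
        [/\ t%:R <= T.[d%:R + N],
            prob D (fun cf => halted cf &&
              ((nsamples cf.2 + nqueries cf.2)%:R <= N)) = 1
          & 99%:R / 100%:R <= prob D (fun cf =>
              (l2norm (zs - output d cf) <= eps) &&
              (dTV (prodD zs) (prodD (output d cf)) <= C' * eps))].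
Proof.
(* [P] to the power [Q] is [K]; [C = 3] covers the [3 * m] draws and queries, [C' = 2] is the factor
   of [dTV_prodD_le], and [k = 0] gives a bound without logarithm. [T] dominates
   [(m + 1) * (d * 40 + 60)], both [m] and [d] being at most [d + N]. *)
exists estimator, (2%:P + 'X), (1400%:P * 'X), (('X + 1%:P) * (40%:P * 'X + 60%:P)), 3, 2, 0%N.
split; first by apply/polyOverP => i; rewrite coefD coefC coefX nnegrE addr_ge0 //; case: ifP.
split; first by apply/polyOverP => i; rewrite coefCM coefX nnegrE mulr_ge0.
move=> d eps alpha lambda S zs eps0 alpha0 lambda0 massS anti N.
set q := prodD_trunc zs S.
have q0 : forall x, 0 <= q x := trunc_ge0 alpha0 massS.
have q1 : \sum_(x : cube d) q x = 1 := trunc_sum1 alpha0 massS.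
pose u := scale alpha lambda; pose K := expR (1400 * u).
pose x := K * (d%:R / eps ^+ 2); pose m := Num.truncn x.
have K0 : 0 <= K := expR_ge0 _.
have x0 : 0 <= x.
  by apply: mulr_ge0 => //; apply: divr_ge0; rewrite ?sqr_ge0.
have a0 : 0 < alpha^-1 by rewrite invr_gt0.
have NE : N = 3 * x.
  rewrite /N /sample_bound expr0 mulr1 !(hornerD, hornerM, hornerC, hornerX) /powR gt_eqF; last by lra.
  rewrite /x /K /u /scale mulrCA; congr (3 * (expR _ * _)); ring.
have mx : m%:R <= x by rewrite truncn_le.
pose t := ((m + 1) * (d * 40 + 60))%N.
exists t => D.
pose st0 : state (R := R) := State (upd (fun=> 0%N) 0 d) (fun j => nth 0 [:: eps; alpha; lambda] j) 0 0.
have run phi (f : state (R := R) -> R) :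
  (forall st, (nsamples st + nqueries st <= 3 * m)%N -> phi (rd (Defs.mem st) 0) <= f st) ->
  algorithm S q eps lambda (33 * u) (expR (604 * u)) (expR (610 * u) * d%:R) m phi <=
  expect D (fun c => (halted c)%:R * f c.2).
  move=> hf; have := @runs_program _ _ _ _ _ d q S q0 eps alpha lambda (33 * u) (expR (604 * u))
    (expR (610 * u)) K lambda0 (@reval_radius _ eps alpha lambda) (@reval_eExp _ 604 eps alpha lambda)
    (@reval_eExp _ 610 eps alpha lambda) (@reval_eExp _ 1400 eps alpha lambda) f st0 phi K0.
  move=> /(_ erefl erefl _ erefl erefl _ hf) h; apply: (h _ _ t (leqnn _)) => //.
  by apply/rowP => i; rewrite !mxE /= ?nth_nil.
have probE (E : config -> bool) : prob D E = expect D (fun c => (E c)%:R) by [].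
have expect_le (F G : config -> R) : (forall c, F c <= G c) -> expect D F <= expect D G.
  by move=> h; apply: (expect_exec_le (q := q)).
have bound (st : state (R := R)) : (nsamples st + nqueries st <= 3 * m)%N ->
    ((nsamples st + nqueries st)%:R <= N)%R.
  rewrite -(ler_nat R) => /le_trans; apply; rewrite NE natrM ler_pM2l //.
split.
- rewrite /t natrM !natrD !natrM !(hornerD, hornerM, hornerC, hornerX) NE.
  have d0 : 0 <= d%:R :> R by [].
  have m0 : 0 <= m%:R :> R by [].
  apply: ler_pM; lra.
- apply/eqP; rewrite eq_le; apply/andP; split.
    apply: (@le_trans _ _ (expect D (fun=> 1))); last by rewrite expect_exec_cst.
    by rewrite probE; apply: expect_le => c; case: (_ && _).
  (* With the constant test function 1, the run bound says that halting within the budget has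
     probability at least 1. *)
  rewrite -[leLHS](algorithm_cst S q1 eps lambda (33 * u) (expR (604 * u)) (expR (610 * u) * d%:R) m 1).
  apply: le_trans (run _ (fun st => ((nsamples st + nqueries st <= 3 * m)%N)%:R) _) _.
    by move=> st ->.
  rewrite probE; apply: expect_le => c; case: (halted c); rewrite ?mul0r // mul1r.
  case: (boolP (nsamples c.2 + nqueries c.2 <= 3 * m)%N) => [/bound|_]; last by rewrite ler0n.
  by rewrite andTb => ->.
pose good (z : 'rV[R]_d) : R := ((l2norm (zs - z) <= eps)%R)%:R.
have hgood : 99 / 100 <= algorithm S q eps lambda (33 * u) (expR (604 * u)) (expR (610 * u) * d%:R) m good.
  (* In dimension 0 every output is exact. Otherwise a coordinate exists, and its mean forces
     [lambda <= 1 / 2], on which the constants rely. *)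
  have [d0|d0] := posnP d.
    have g1 z : good z = 1.
      rewrite /good l2norm_le ?(ltW eps0) // /sqn big1 ?sqr_ge0 // => i _.
      by have := ltn_ord i; rewrite {2}d0.
    rewrite (_ : good = fun=> 1); last by apply/funext => z; exact: g1.
    rewrite algorithm_cst //; lra.
  have al1 := alpha_le1 massS.
  have l2 : lambda <= 1 / 2.
    by have := tmean_bounds alpha0 lambda0 massS anti (Ordinal d0); lra.
  have sJ : expR (604 * u) <= expR (610 * u).
    by rewrite ler_expR ler_wpM2r //; have := scale_ge1 alpha0 al1 lambda0 l2; rewrite -/u; lra.
  exact: (algorithm_good alpha0 lambda0 massS anti eps0 (radius_ge alpha0 al1 lambda0 l2)
    (expR_gt0 _) (curvature_ge alpha0 al1 lambda0 l2) sJ (time_radius_ge alpha0 al1 lambda0 l2)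
    (count_radius_ge alpha0 al1 lambda0 l2) (count_s_ge alpha0 al1 lambda0 l2)
    (count_time_ge alpha0 al1 lambda0 l2) d0).
apply: le_trans hgood _.
apply: le_trans (run _ (fun st => good (rd (Defs.mem st) 0)) _) _ => //.
rewrite probE; apply: expect_le => c; case: (halted c); rewrite ?mul0r ?ler0n // mul1r /good.
rewrite -[rd _ _]/(output d c); case: (boolP (l2norm (zs - output d c) <= eps)%R) => //= h.
have -> // : dTV (prodD zs) (prodD (output d c)) <= 2 * eps.
by apply: le_trans (dTV_prodD_le _ _) _; rewrite ler_pM2l.
Qed.
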